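(* Let $m>0$, $S>0$, and let $\mathrm{Ad}=\mathrm{Ad}(m,S)$ be the family of regular strings $dM$ with $0<\mathrm{Tm}_M\le m$ and $0\le\mathrm{Stm}_M\le S$. For $\alpha\in\mathbb{R}$ let $$\mathcal{I}(\alpha):=\inf\{\operatorname{Im}\kappa:\ \operatorname{Re}\kappa=\alpha \text{ and } \kappa\in K(dM)\text{ for some } dM\in \mathrm{Ad}\}.$$ Let $\alpha\in(-S^{-1/2},S^{-1/2})$ and $\kappa^{[\alpha]}:=\alpha+\mathrm{i}\,\mathcal{I}(\alpha)$. Then there exists a unique string $dM_\alpha\in\mathrm{Ad}$ such that $\kappa^{[\alpha]}\in K(dM_\alpha)$ (the optimal string for the frequency $\alpha$). The string $dM_\alpha$ is of the form $d\Delta_{x_0,A}$ and satisfies at least one of the equalities $\mathrm{Tm}_M=m$, $\mathrm{Stm}_M=S$ (with $dM=dM_\alpha$). More precisely, $dM_0=d\Delta_{1,m}$, and for $0<\alpha<S^{-1/2}$ one has $dM_\alpha=dM_{-\alpha}=d\Delta_{x_0,A}$ with $x_0$ and $A$ given as follows. When $S\le m^2/4$: $$x_0=1-\frac{1}{2(S^{-1}-\alpha^2)^{1/2}},\qquad A=2S\sqrt{S^{-1}-\alpha^2}.$$ When $S>m^2/4$: $$(x_0,A)=\begin{cases}\left(1-\dfrac{m}{2+2(1-\alpha^2m^2)^{1/2}},\ m\right), & 0<\alpha<\sqrt{\dfrac1S-\dfrac{m^2}{4S^2}},\\[3mm] \left(1-\dfrac{1}{2(S^{-1}-\alpha^2)^{1/2}},\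 2S\sqrt{S^{-1}-\alpha^2}\right), & \sqrt{\dfrac1S-\dfrac{m^2}{4S^2}}\le\alpha< S^{-1/2}.\end{cases}$$
   Context: For $x_0\le1$ and $A>0$, $d\Delta_{x_0,A}$ denotes the string consisting of a single atom of mass $A$ at $x_0$, i.e. $A$ times the Dirac measure at $x_0$. A (Krein) string is a locally bounded nonnegative Borel measure $dM$ on $(-\infty,1]$. Its total mass is $\mathrm{Tm}_M=\int_{(-\infty,1]}dM$ and its statical moment with respect to the right end is $\mathrm{Stm}_M=\int_{(-\infty,1]}(1-x)\,dM(x)$. The string is regular if $\operatorname{supp}dM$ is bounded from below; its left end $a_1$ is then the infimum of $\operatorname{supp} dM$ (with $a_1=1$ if $dM=0$). Quasi-eigenvalues of a regular string are the $\kappa\in\mathbb{C}$ for which $$-\frac{d^2}{dM\,dx}y(x)=\kappa^2y(x),\quad \partial_x^-y(a_1)=0,\quad y(1)=\frac{\mathrm{i}}{\kappa}\,\partial_x^+y(1)$$ has a nonzero solution $y$. The equation is understood in the integral sense: together with the left boundary condition it means $y(x)=c-\kappa^2\int_{(-\infty,x]}(x-s)y(s)\,dM(s)$ with a constant $c$, and $\partial_x^+y(1)=-\kappa^2\int_{(-\infty,1]}y(s)\,dM(s)$ (an atom of $dM$ at $1$ is included). Equivalently, the set $K(dM)$ of quasi-eigenvalues is the zero set of the entire function $$F(z)=\varphi(1,z)-\mathrm{i}\,\partial_x^+\varphi(1,z)/z=\varphi(1,z)+\mathrm{i}z\int_{(-\infty,1]}\varphi(s,z)\,dM(s),$$ where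 $\varphi(\cdot,z)$ is the solution of $\varphi(x,z)=1-z^2\int_{(-\infty,x]}(x-s)\varphi(s,z)\,dM(s)$. *)

(* Defs.v *)
From HB Require Import structures.
From mathcomp Require Import all_boot all_order all_algebra.
From mathcomp Require Import all_classical all_reals all_analysis.
From mathcomp Require Import complex.

Set Implicit Arguments.
Unset Strict Implicit.
Unset Printing Implicit Defensive.

Import Order.TTheory GRing.Theory Num.Theory.
Import numFieldNormedType.Exports.

Local Open Scope classical_set_scope.
Local Open Scope complex_scope.
Local Open Scope ring_scope.

Section Strings.
Variable R : realType.
Implicit Types (M N : {measure set (measurableTypeR R) -> \bar R}).
Implicit Types (kappa : R[i]) (y : R -> R[i]).

(* A Borel measure on (-oo, 1] is represented as a Borel measure on the real
   line that vanishes on ]1, +oo[. *)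
Definition krein_string M : Prop :=
  M `]1, +oo[%classic = 0%E /\ forall a : R, (M `[a, 1%R]%classic < +oo)%E.

Definition supp M : set R :=
  [set x | forall U : set R, open U -> U x -> (0 < M U)%E].

Definition regular_string M : Prop := krein_string M /\ has_lbound (supp M).

Definition Tm M : \bar R := M `]-oo, 1]%classic.

Definition Stm M : \bar R := (\int[M]_(x in `]-oo, 1%R]) (1 - x)%:E)%E.

Definition Ad (m S : R) M : Prop :=
  [/\ regular_string M,
      (0 < Tm M)%E /\ (Tm M <= m%:E)%E &
      (0 <= Stm M)%E /\ (Stm M <= S%:E)%E].

(* The values of a measure in MathComp-Analysis are meaningful on measurable
   sets only, so equality of measures is stated on the Borel sets. *)
Definition same_string M N : Prop :=
  forall B : set (measurableTypeR R), measurable B -> M B = N B.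

(* M is the string with a single atom, of mass A, located at x0. *)
Definition is_point_mass M (x0 A : R) : Prop :=
  [/\ x0 <= 1, 0 < A &
      forall B : set (measurableTypeR R), measurable B ->
        M B = (A%:E * \d_(x0 : measurableTypeR R) B)%E].

Definition Cintegrable M (D : set R) (f : R -> R[i]) : Prop :=
  M.-integrable D (fun x => (complex.Re (f x))%:E) /\
  M.-integrable D (fun x => (complex.Im (f x))%:E).

Definition Cintegral M (D : set R) (f : R -> R[i]) : R[i] :=
  (\int[M]_(x in D) complex.Re (f x)) +i* (\int[M]_(x in D) complex.Im (f x)).

(* y solves -d^2 y / (dM dx) = kappa^2 y on (-oo, 1] with zero left derivative
   at the left end of M. *)
Definition string_solution M kappa y : Prop :=
  Cintegrable M `]-oo, 1]%classic y /\
  exists c : R[i], forall x : R, x <= 1 ->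
    y x = c - kappa ^+ 2 * Cintegral M `]-oo, x]%classic (fun s => (x - s)%:C * y s).

(* The right derivative at 1 of a solution y; it accounts for an atom of M
   at 1. *)
Definition right_derivative_at1 M kappa y : R[i] :=
  - kappa ^+ 2 * Cintegral M `]-oo, 1]%classic y.

Definition quasi_eigenvalues M : set R[i] :=
  [set kappa | kappa != 0 /\
    exists y : R -> R[i],
      [/\ string_solution M kappa y,
          exists2 x : R, x <= 1 & y x != 0 &
          y 1 = 'i%C / kappa * right_derivative_at1 M kappa y]].

Definition min_decay (m S alpha : R) : \bar R :=
  ereal_inf [set (complex.Im kappa)%:E | kappa in
    [set kappa : R[i] | complex.Re kappa = alpha /\
       exists2 M : {measure set (measurableTypeR R) -> \bar R}, Ad m S M & quasi_eigenvalues M kappa]].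

(* Meaningful when [min_decay m S alpha] is finite. *)
Definition kappa_opt (m S alpha : R) : R[i] :=
  alpha +i* fine (min_decay m S alpha).

Definition optimal_string (m S alpha : R) M : Prop :=
  Ad m S M /\ quasi_eigenvalues M (kappa_opt m S alpha).

End Strings.

(* Main.v *)
Require Import Defs.
From HB Require Import structures.
From mathcomp Require Import all_boot all_order all_algebra.
From mathcomp Require Import all_classical all_reals all_analysis.
From mathcomp Require Import complex measurable_realfun.
From mathcomp Require Import ring lra.

(**
Write y = u + iv for an eigenfunction of the string M at kappa = alpha + i beta,
a for the integral of |y|^2 and W for |integral of y|^2 with respect to M.
Subtracting from the equation its value at 1 gives
y(x) = y(1) + kappa^2 * integral of (1 - max(x, s)) y(s) dM(s), with
y(1) = - i kappa * integral of y dM.  Pairing with the conjugate of y, and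
writing Q for the (real) quadratic form of the kernel 1 - max(x, s), one gets
  a = beta W + (alpha^2 - beta^2) Q   and   alpha W = 2 alpha beta Q.
The kernel is the integral over t of 1_{x <= t} 1_{s <= t}, so that Q >= 0, and
Cauchy-Schwarz gives W <= Tm a and Q <= Stm a.  For alpha <> 0 it follows that
1 <= Stm |kappa|^2 and 2 beta <= Tm |kappa|^2, for alpha = 0 that
1 <= beta Tm.  Equality in one of the Cauchy-Schwarz inequalities forces the
string to be a single atom, for which the eigenvalue equation is
kappa^2 A (1 - x0) - i kappa A = 1; the rest is elementary algebra.
*)

Import Order.TTheory GRing.Theory Num.Theory.
Import numFieldNormedType.Exports.
Local Open Scope classical_set_scope.
Local Open Scope ring_scope.

(** When [alpha] is nonzero, the eigenvalue equation of one atom determines that atom: the imaginary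
    part gives 1 - x0 = 1 / (2 beta), and then the real part gives A = 2 beta / nu with nu = alpha^2
    + beta^2. Its statical moment is 1 / nu, so A <= m and A (1 - x0) <= S are the two necessary
    bounds themselves. The extremal problem over measures thus becomes the search for the least b >=
    0 satisfying two scalar inequalities, one of which is an equality at the minimum. Uniqueness
    rests on the equality cases. Both lead to the statement that h(x) = integral of max(x - s, 0)
    dM(s) is constant almost everywhere for the string; h is convex and increases wherever there is
    mass to the left, so only a single atom allows this. An eigenfunction is given only as an
    integrable complex function on a half-line. The string is therefore restricted to an interval
    [L, 1] of full measure that also contains a point where y is nonzero, y is split into real and
    imaginary parts, and its boundedness is read off the integral equation. *)

(** * Bounded measurable functions on a set of finite measure *)

Section BoundedMeasurable.
Local Set Implicit Arguments.
Local Unset Strict Implicit.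
Context {d} {T : measurableType d} {R : realType}.

(** On a set of finite measure every function of this class is integrable, and the class is closed
    under sums and products. Kernels, indicators and solutions on [[L, 1]] all belong to it, so
    linearity of the integral needs no further integrability argument. *)
Definition bmeas (D : set T) (f : T -> R) : Prop :=
  measurable_fun D f /\ exists K, forall x, D x -> `|f x| <= K.

Lemma bmeas_cst D c : bmeas D (fun=> c).
Proof. by split; [exact: measurable_cst | exists `|c|]. Qed.

Lemma bmeasD D f g : bmeas D f -> bmeas D g -> bmeas D (fun x => f x + g x).
Proof.
move=> [mf [K fK]] [mg [K' gK']]; split; first exact: measurable_funD.
by exists (K + K') => x Dx; rewrite (le_trans (ler_normD _ _))// lerD ?fK ?gK'.
Qed.

Lemma bmeasN D f : bmeas D f -> bmeas D (fun x => - f x).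
Proof.
move=> [mf [K fK]]; split; first exact: measurableT_comp.
by exists K => x Dx; rewrite normrN fK.
Qed.

Lemma bmeasB D f g : bmeas D f -> bmeas D g -> bmeas D (fun x => f x - g x).
Proof. by move=> mf /bmeasN; exact: bmeasD. Qed.

Lemma bmeasM D f g : bmeas D f -> bmeas D g -> bmeas D (fun x => f x * g x).
Proof.
move=> [mf [K fK]] [mg [K' gK']]; split; first exact: measurable_funM.
by exists (K * K') => x Dx; rewrite normrM ler_pM ?fK ?gK'.
Qed.

Lemma bmeasX D f n : bmeas D f -> bmeas D (fun x => f x ^+ n).
Proof.
move=> bf; elim: n => [|n IH]; first exact: bmeas_cst.
by under eq_fun do rewrite exprS; exact: bmeasM.
Qed.

Lemma bmeas_bool D (b : T -> bool) :
  measurable_fun D b -> bmeas D (fun x => (b x)%:R).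
Proof.
move=> mb; split; last by exists 1 => x _; case: (b x); rewrite ?normr1 ?normr0.
rewrite (_ : (fun x => _) = (fun b : bool => b%:R : R) \o b)//.
exact: measurableT_comp.
Qed.

Lemma bmeas_bounded D f : bmeas D f -> [bounded f x | x in D].
Proof.
move=> [_ [K fK]]; exists K; split; first exact: num_real.
by move=> M KM x Dx; apply: le_trans (fK _ Dx) (ltW KM).
Qed.

Context (mu : {measure set T -> \bar R}) (D : set T).
Hypotheses (mD : measurable D) (muD : (mu D < +oo)%E).

Lemma bmeas_integrable f : bmeas D f -> mu.-integrable D (EFin \o f).
Proof.
move=> bf; apply: measurable_bounded_integrable => //; first by case: bf.
exact: bmeas_bounded.
Qed.

(** Only one factor is bounded: this covers the stage at which a solution is known to be integrable
    but not yet bounded. *)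
Lemma bmeas_integrableM f g : bmeas D f -> mu.-integrable D (EFin \o g) ->
  mu.-integrable D (EFin \o (fun x => f x * g x)).
Proof. by move=> bf; apply: integrableMr; [|case: bf|exact: bmeas_bounded]. Qed.

Local Notation I f := (\int[mu]_(x in D) f x).

Lemma bintD f g : bmeas D f -> bmeas D g -> I (fun x => f x + g x) = I f + I g.
Proof. by move=> *; rewrite RintegralD//; exact: bmeas_integrable. Qed.

Lemma bintB f g : bmeas D f -> bmeas D g -> I (fun x => f x - g x) = I f - I g.
Proof. by move=> *; rewrite RintegralB//; exact: bmeas_integrable. Qed.

Lemma bintZ c f : bmeas D f -> I (fun x => c * f x) = c * I f.
Proof. by move=> *; rewrite RintegralZl//; exact: bmeas_integrable. Qed.

Lemma le_bint f g : bmeas D f -> bmeas D g -> (forall x, D x -> f x <= g x) ->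
  I f <= I g.
Proof. by move=> *; apply: le_Rintegral => //; exact: bmeas_integrable. Qed.

Lemma bint_eq0 f : bmeas D f -> (forall x, D x -> 0 <= f x) -> I f = 0 ->
  {ae mu, forall x, D x -> f x = 0}.
Proof.
move=> bf f0 If; have mf : measurable_fun D (EFin \o f).
  by apply/measurable_EFinP; case: bf.
have : ae_eq mu D (EFin \o f) (cst 0%E).
  apply/ae_eq_integral_abs => //.
  under eq_integral => x /set_mem Dx do rewrite /= ger0_norm ?f0//.
  have ? := integrable_fin_num mD (bmeas_integrable bf).
  by rewrite -(fineK (x := \int[mu]_(x in D) (f x)%:E))// [fine _]If.
by apply: filterS => x /= + Dx => /(_ Dx) [].
Qed.

Lemma ae_eq_bint f g : bmeas D f -> bmeas D g ->
  {ae mu, forall x, D x -> f x = g x} -> I f = I g.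
Proof.
move=> [mf _] [mg _] fg; congr fine.
apply: ae_eq_integral => //; [exact/measurable_EFinP..|].
by apply: filterS fg => x /= fg Dx; rewrite fg.
Qed.

(** Cauchy-Schwarz with weight w. If W and J are the integrals of w and w f, the integral of w (W f
    - J)^2 is nonnegative and equals W times the difference of the two sides. *)
Lemma bint_sqr_le w f : bmeas D w -> bmeas D f -> (forall x, D x -> 0 <= w x) ->
  I (fun x => w x * f x) ^+ 2 <= I w * I (fun x => w x * f x ^+ 2).
Proof.
move=> bw bf w0; set J := I (fun x => w x * f x).
have [K fK] := bf.2.
have [bwf bwf2] : bmeas D (fun x => w x * f x) /\ bmeas D (fun x => w x * f x ^+ 2).
  by split; apply: bmeasM => //; exact: bmeasX.
have Iw0 : 0 <= I w by exact: Rintegral_ge0.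
(* The factor W cannot be cancelled when it is zero; in that case J = 0 because |J| <= |K| W. *)
have [Iw|Iw] := eqVneq (I w) 0.
  rewrite Iw mul0r; have : `|J| <= `|K| * I w.
    rewrite -bintZ//; apply: le_trans (le_normr_Rintegral mD (bmeas_integrable bwf)) _.
    apply: le_bint.
    - by split; [apply: measurableT_comp => //; case: bwf
        |case: bwf => _ [k ?]; exists k => x Dx; rewrite normr_id; auto].
    - by apply: bmeasM => //; exact: bmeas_cst.
    - move=> x Dx; rewrite normrM (ger0_norm (w0 _ Dx)) mulrC ler_wpM2r ?w0//.
      by rewrite (le_trans (fK _ Dx))// ler_norm.
  by rewrite Iw mulr0 normr_le0 => /eqP ->; rewrite expr0n.
have : 0 <= I (fun x => w x * (I w * f x - J) ^+ 2).
  by apply: Rintegral_ge0 => x Dx; rewrite mulr_ge0 ?w0 ?sqr_ge0.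
rewrite (_ : (fun x => _) = (fun x => (I w ^+ 2 * (w x * f x ^+ 2)
    - (I w * J *+ 2) * (w x * f x)) + J ^+ 2 * w x)); last first.
  by apply/funext => x; ring.
have b1 : bmeas D (fun x => I w ^+ 2 * (w x * f x ^+ 2)) by apply: bmeasM => //; exact: bmeas_cst.
have b2 : bmeas D (fun x => (I w * J *+ 2) * (w x * f x)) by apply: bmeasM => //; exact: bmeas_cst.
have b3 : bmeas D (fun x => J ^+ 2 * w x) by apply: bmeasM => //; exact: bmeas_cst.
rewrite bintD//; last exact: bmeasB.
rewrite bintB// !bintZ// -/J.
rewrite (_ : _ - _ + _ = I w * (I w * I (fun x => w x * f x ^+ 2) - J ^+ 2)); last by ring.
by rewrite pmulr_rge0 ?subr_ge0// lt_neqAle eq_sym Iw.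
Qed.

(** The integral of (W f - J)^2 is W times the Cauchy-Schwarz defect, hence zero. The conclusion
    stays multiplied by the total mass W, which may vanish here. *)
Lemma bint_sqr_eq f : bmeas D f ->
  I f ^+ 2 = I (fun=> 1) * I (fun x => f x ^+ 2) ->
  {ae mu, forall x, D x -> I (fun=> 1) * f x = I f}.
Proof.
move=> bf E; set W := I (fun=> 1); set J := I f.
have b1 : bmeas D (fun x => W ^+ 2 * f x ^+ 2).
  by apply: bmeasM; [exact: bmeas_cst|exact: bmeasX].
have b2 : bmeas D (fun x => (W * J *+ 2) * f x) by apply: bmeasM => //; exact: bmeas_cst.
have b3 : bmeas D (fun x => J ^+ 2 * 1) by exact: bmeas_cst.
have : I (fun x => (W * f x - J) ^+ 2) = 0.
  rewrite (_ : (fun x => _) = (fun x => (W ^+ 2 * f x ^+ 2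
    - (W * J *+ 2) * f x) + J ^+ 2 * 1)); last by apply/funext => x; ring.
  rewrite bintD//; last exact: bmeasB.
  rewrite bintB// !bintZ//; [|exact: bmeas_cst|exact: bmeasX].
  by rewrite -/J -/W expr2 -mulrA -E -/J; ring.
move/bint_eq0 => H.
have : {ae mu, forall x, D x -> (W * f x - J) ^+ 2 = 0}.
  apply: H => [|x _]; last exact: sqr_ge0.
  by apply/bmeasX/bmeasB; [apply: bmeasM => //|]; exact: bmeas_cst.
apply: filterS => x /= + Dx => /(_ Dx)/eqP.
by rewrite sqrf_eq0 subr_eq0 => /eqP.
Qed.

End BoundedMeasurable.

(** * Exchange of integrals for bounded functions on a rectangle *)

Section BoundedFubini.
Local Set Implicit Arguments.
Local Unset Strict Implicit.
Context {d1 d2} {T1 : measurableType d1} {T2 : measurableType d2} {R : realType}.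
Context (m1 : {sigma_finite_measure set T1 -> \bar R}).
Context (m2 : {sigma_finite_measure set T2 -> \bar R}).
Context (D : set T1) (E : set T2).
Hypotheses (mD : measurable D) (mE : measurable E).
Hypotheses (m1D : (m1 D < +oo)%E) (m2E : (m2 E < +oo)%E).
Context (F : T1 * T2 -> R).
Hypothesis bF : bmeas (D `*` E) F.

(** Extension by zero turns integrals over [D] and [E] into integrals over the whole spaces, where
    Fubini's theorem applies; [G] is integrable because the rectangle has finite product measure. *)
Let G : T1 * T2 -> \bar R := EFin \o (F \_ (D `*` E)).

Let mDE : measurable (D `*` E). Proof. exact: measurableX. Qed.

Let GE x y : D x -> E y -> G (x, y) = (F (x, y))%:E.
Proof. by move=> Dx Ey; rewrite /G /= patchE mem_set. Qed.

Let G0 x y : ~ (D x /\ E y) -> G (x, y) = 0%E.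
Proof. by move=> nDE; rewrite /G /= patchE memNset. Qed.

Let integrableG : (m1 \x m2)%E.-integrable setT G.
Proof.
rewrite /G -restrict_EFin; apply/(integrable_mkcond _ mDE).
by apply: bmeas_integrable => //=; rewrite product_measure1E// lte_mul_pinfty// ge0_fin_numE.
Qed.

Let mG : measurable_fun setT G.
Proof. exact: measurable_int integrableG. Qed.

Let bF1 x : D x -> bmeas E (fun y => F (x, y)).
Proof.
move=> Dx; split; last by case: bF => _ [K FK]; exists K => y Ey; exact: FK.
apply/measurable_EFinP; apply: (eq_measurable_fun (fun y => G (x, y))).
  by move=> y /set_mem Ey; rewrite GE.
by apply: measurable_funTS; exact: measurableT_comp (pair1_measurable x).
Qed.

Let bF2 y : E y -> bmeas D (fun x => F (x, y)).
Proof.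
move=> Ey; split; last by case: bF => _ [K FK]; exists K => x Dx; exact: FK.
apply/measurable_EFinP; apply: (eq_measurable_fun (fun x => G (x, y))).
  by move=> x /set_mem Dx; rewrite GE.
by apply: measurable_funTS; exact: measurableT_comp (pair2_measurable y).
Qed.

Let intG1 x : (\int[m2]_y G (x, y) = (EFin \o ((fun x => (\int[m2]_(y in E) F (x, y))%R) \_ D)) x)%E.
Proof.
rewrite [RHS]/= patchE; case: ifPn => [/set_mem Dx|/negP Dx].
  rewrite fineK; last exact: integrable_fin_num (bmeas_integrable mE m2E (bF1 Dx)).
  rewrite [RHS]integral_mkcond; apply: eq_integral => y _; rewrite patchE.
  case: ifPn => [/set_mem Ey|/negP Ey]; first by rewrite GE.
  by apply: G0 => -[_ /mem_set].
by rewrite (eq_integral (cst 0%E)) ?integral0// => y _; apply: G0 => -[/mem_set].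
Qed.

Let intG2 y : (\int[m1]_x G (x, y) = (EFin \o ((fun y => (\int[m1]_(x in D) F (x, y))%R) \_ E)) y)%E.
Proof.
rewrite [RHS]/= patchE; case: ifPn => [/set_mem Ey|/negP Ey].
  rewrite fineK; last exact: integrable_fin_num (bmeas_integrable mD m1D (bF2 Ey)).
  rewrite [RHS]integral_mkcond; apply: eq_integral => x _; rewrite patchE.
  case: ifPn => [/set_mem Dx|/negP Dx]; first by rewrite GE.
  by apply: G0 => -[/mem_set].
by rewrite (eq_integral (cst 0%E)) ?integral0// => x _; apply: G0 => -[_ /mem_set].
Qed.

Lemma bmeas_section_integral : bmeas D (fun x => \int[m2]_(y in E) F (x, y)).
Proof.
split.
  apply/(measurable_restrictT _ mD)/measurable_EFinP.
  by have := measurable_fubini_F integrableG; rewrite /fubini_F (funext intG1).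
have [_ [K FK]] := bF; exists (`|K| * fine (m2 E)) => x Dx.
apply: le_trans (le_normr_Rintegral mE (bmeas_integrable mE m2E (bF1 Dx))) _.
rewrite -Rintegral_cst//; apply: le_bint => //.
- have [mf [k fk]] := bF1 Dx; split; first exact: measurableT_comp.
  by exists k => y Ey; rewrite normr_id fk.
- exact: bmeas_cst.
- by move=> y Ey; rewrite (le_trans (FK (x, y) _))// ler_norm.
Qed.

Lemma bmeas_Fubini :
  \int[m1]_(x in D) \int[m2]_(y in E) F (x, y) =
  \int[m2]_(y in E) \int[m1]_(x in D) F (x, y).
Proof.
rewrite Rintegral_mkcond [RHS]Rintegral_mkcond; congr fine.
under eq_integral do rewrite -[_%:E]intG1.
under [RHS]eq_integral do rewrite -[_%:E]intG2.
exact: Fubini.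
Qed.

End BoundedFubini.

(** * Cumulative integrals, moments and integration by parts *)

Section GreenForm.
Local Set Implicit Arguments.
Local Unset Strict Implicit.
Context {R : realType} (mu : {finite_measure set (measurableTypeR R) -> \bar R}).
Context (L : R) (L1 : L <= 1).
Local Notation D := (`[L, 1%R]%classic : set (measurableTypeR R)).
Local Notation E := (`[L, 1%R[%classic : set (measurableTypeR R)).
Local Notation leb := (@lebesgue_measure R).
Local Notation I f := (\int[mu]_(x in D) f x).
Local Notation J f := (\int[leb]_(x in E) f x).
Implicit Types (u v : R -> R).

(** The integral of u over [L, t], whose primitive from L is [moment u]. The indicator inside the
    integral keeps the domain of integration fixed for the exchange of integrals. *)
Definition cumul u (t : R) : R := I (fun s : R => (s <= t)%R%:R * u s).
(* For L <= x <= 1 this is the integral of (x - s) u(s) over [L, x]. *)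
Definition moment u (x : R) : R := I (fun s : R => Num.max (x - s) 0 * u s).

Let mD : measurable D. Proof. exact: measurable_itv. Qed.
Let mE : measurable E. Proof. exact: measurable_itv. Qed.
Let muD : (mu D < +oo)%E.
Proof. by rewrite ltey_eq fin_num_measure. Qed.
Let lebE : (leb E < +oo)%E.
Proof. by rewrite lebesgue_measure_itv/=; case: ifP => _; rewrite ?ltry. Qed.

Lemma bmeas_id : bmeas D idfun.
Proof.
split; first exact: measurable_id.
exists (`|L| + 1) => x; rewrite /= in_itv/= ler_norml => /andP[? ?].
have := ler_norm (- L); rewrite normrN; have := normr_ge0 L; lra.
Qed.

Lemma bmeas_max (A : set (measurableTypeR R)) u v : bmeas A u -> bmeas A v ->
  bmeas A (fun x => Num.max (u x) (v x)).
Proof.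
move=> [mu' [K uK]] [mv [K' vK]]; split; first exact: measurable_maxr.
exists (K + K') => x Ax; have := uK _ Ax; have := vK _ Ax.
have := normr_ge0 (u x); have := normr_ge0 (v x).
by case: (leP (u x) (v x)) => _; lra.
Qed.

Lemma bmeas_le (A : set (measurableTypeR R)) u v : measurable_fun A u -> measurable_fun A v ->
  bmeas A (fun x => (u x <= v x)%R%:R : R).
Proof. by move=> *; apply/bmeas_bool/measurable_fun_ler. Qed.

Lemma bmeas_lt (A : set (measurableTypeR R)) u v : measurable_fun A u -> measurable_fun A v ->
  bmeas A (fun x => (u x < v x)%R%:R : R).
Proof. by move=> *; apply/bmeas_bool/measurable_fun_ltr. Qed.

Lemma bmeas_fst u : bmeas D u -> bmeas (D `*` E) (fun z => u z.1).
Proof.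
move=> [mu' [K uK]]; split; last by exists K => z [/uK].
apply: (measurable_comp (F := D)) => //; last exact: measurable_funTS.
by move=> _ [z [Dz _] <-].
Qed.

Lemma bmeas_snd u : bmeas E u -> bmeas (D `*` E) (fun z => u z.2).
Proof.
move=> [mu' [K uK]]; split; last by exists K => z [_ /uK].
apply: (measurable_comp (F := E)) => //; last exact: measurable_funTS.
by move=> _ [z [_ Ez] <-].
Qed.

Let bm_le : bmeas (D `*` E) (fun z : R * R => (z.1 <= z.2)%R%:R : R).
Proof. by apply/bmeas_bool/measurable_fun_ler; exact: measurable_funTS. Qed.

Let bm_lt : bmeas (D `*` E) (fun z : R * R => (z.2 < z.1)%R%:R : R).
Proof. by apply/bmeas_bool/measurable_fun_ltr; exact: measurable_funTS. Qed.

Lemma bmeas_cumul u : bmeas D u -> bmeas E (cumul u).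
Proof.
move=> bu.
have bF : bmeas (E `*` D) (fun z : R * R => (z.2 <= z.1)%R%:R * u z.2).
  apply: bmeasM; first by apply/bmeas_bool/measurable_fun_ler; exact: measurable_funTS.
  move: bu => [mu' [K uK]]; split; last by exists K => z [_ /uK].
  apply: (measurable_comp (F := D)) => //; last exact: measurable_funTS.
  by move=> _ [z [_ Dz] <-].
exact: (bmeas_section_integral (m1 := leb) (m2 := mu) mE mD lebE muD bF).
Qed.

(** max(x - s, 0) is the length of [s, x[, that is, the Lebesgue integral over [L, 1[ of the
    indicator of s <= t < x; the integrals are then exchanged. *)
Lemma moment_cumul u x : bmeas D u -> D x ->
  moment u x = J (fun t => (t < x)%R%:R * cumul u t).
Proof.
move=> bu Dx.
have mlex : bmeas E (fun t : R => (t < x)%R%:R : R) by exact: bmeas_lt.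
have bF : bmeas (D `*` E) (fun z : R * R => u z.1 * ((z.1 <= z.2)%R%:R * (z.2 < x)%R%:R)).
  apply: bmeasM; first exact: bmeas_fst.
  by apply: bmeasM => //; exact: (bmeas_snd mlex).
have := bmeas_Fubini (m1 := mu) (m2 := leb) mD mE muD lebE bF => /= F.
transitivity (I (fun s => J (fun t => u s * ((s <= t)%R%:R * (t < x)%R%:R)))).
  apply: eq_Rintegral => s /set_mem Ds.
  rewrite bintZ//; last first.
    by apply: bmeasM => //; exact: bmeas_le.
  rewrite mulrC; congr (_ * _).
  transitivity (J ((cst (1 : R) : R -> R) \_ `[s, x[%classic)).
    rewrite -Rintegral_mkcondr (_ : _ `&` _ = `[s, x[%classic); last first.
      apply/seteqP; split => [t []//|t].
      move: Ds Dx; rewrite /= !in_itv/= => /andP[? ?] /andP[? ?] /andP[? ?].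
      by split; apply/andP; split => //; lra.
    rewrite Rintegral_cst// mul1r.
    rewrite [X in fine X](_ : _ = if s < x then (x - s)%:E else 0%E); last first.
      by rewrite [LHS]lebesgue_measure_itv/= lte_fin EFinB.
    have [sx|xs] := ltP s x; first by rewrite max_l// subr_ge0 ltW.
    by rewrite max_r// subr_le0.
  apply: eq_Rintegral => t _; rewrite patchE mem_setE in_itv/=.
  by case: (s <= t); case: (t < x); rewrite /= ?mul0r ?mulr0 ?mulr1.
rewrite F; apply: eq_Rintegral => t _.
rewrite -bintZ//; last by apply: bmeasM => //; exact: bmeas_le.
by apply: eq_Rintegral => s _; ring.
Qed.

(** Integration by parts: after exchanging the integrals, [cumul u t] is multiplied by the integral
    of v over x > t, which is [I v - cumul v t]. *)
Lemma bint_moment u v : bmeas D u -> bmeas D v ->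
  I (fun x => v x * moment u x) =
  moment u 1 * I v - J (fun t => cumul u t * cumul v t).
Proof.
move=> bu bv; have bP := bmeas_cumul bu; have bQ := bmeas_cumul bv.
have bF : bmeas (D `*` E) (fun z : R * R => v z.1 * ((z.2 < z.1)%R%:R * cumul u z.2)).
  apply: bmeasM; first exact: bmeas_fst.
  by apply: bmeasM => //; exact: bmeas_snd.
have := bmeas_Fubini (m1 := mu) (m2 := leb) mD mE muD lebE bF => /= F.
transitivity (I (fun x => J (fun t => v x * ((t < x)%R%:R * cumul u t)))).
  apply: eq_Rintegral => x /set_mem Dx; rewrite moment_cumul// bintZ//.
  by apply: bmeasM => //; exact: bmeas_lt.
rewrite F; transitivity (J (fun t => I v * cumul u t - cumul u t * cumul v t)).
  apply: eq_Rintegral => t _.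
  transitivity (cumul u t * I (fun x => v x - (x <= t)%R%:R * v x)).
    rewrite -bintZ//.
      by apply: eq_Rintegral => x _; case: ltP => _; rewrite /=; ring.
    by apply: bmeasB => //; apply: bmeasM => //; exact: bmeas_le.
  rewrite bintB//; last by apply: bmeasM => //; exact: bmeas_le.
  by rewrite -/(cumul v t); ring.
rewrite bintB//; [|by apply: bmeasM => //; exact: bmeas_cst|exact: bmeasM].
rewrite bintZ// mulrC; congr (_ * _ - _).
have D1 : D 1 by rewrite /= in_itv/= L1 lexx.
rewrite (moment_cumul bu D1).
(* [E] excludes the point 1, so the indicator of t < 1 is 1 on all of it. *)
by apply: eq_Rintegral => t; rewrite inE/= in_itv/= => /andP[_ ->]; rewrite mul1r.
Qed.

End GreenForm.

(** * The Green form, and strings whose moment is constant almost everywhere *)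

Section StringForm.
Local Set Implicit Arguments.
Local Unset Strict Implicit.
Context {R : realType} (mu : {finite_measure set (measurableTypeR R) -> \bar R}).
Context (L : R) (L1 : L <= 1).
Local Notation D := (`[L, 1%R]%classic : set (measurableTypeR R)).
Local Notation E := (`[L, 1%R[%classic : set (measurableTypeR R)).
Local Notation leb := (@lebesgue_measure R).
Local Notation I f := (\int[mu]_(x in D) f x).
Local Notation J f := (\int[leb]_(x in E) f x).
Local Notation moment := (moment mu L).
Local Notation cumul := (cumul mu L).
Implicit Types (u v : R -> R).

Let mD : measurable D. Proof. exact: measurable_itv. Qed.
Let mE : measurable E. Proof. exact: measurable_itv. Qed.
Let muD : (mu D < +oo)%E.
Proof. by rewrite ltey_eq fin_num_measure. Qed.
Let lebE : (leb E < +oo)%E.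
Proof. by rewrite lebesgue_measure_itv/=; case: ifP => _; rewrite ?ltry. Qed.
Let D1 : D 1. Proof. by rewrite /= in_itv/= L1 lexx. Qed.

Let bm1 c : bmeas D (fun=> c : R). Proof. exact: bmeas_cst. Qed.

Let bmk x : bmeas D (fun s => Num.max (x - s) 0).
Proof. by apply: bmeas_max => //; apply: bmeasB => //; exact: bmeas_id. Qed.

Lemma bmeas_moment u : bmeas D u -> bmeas D (moment u).
Proof.
move=> bu; have bP := bmeas_cumul mu bu.
have bF : bmeas (D `*` E) (fun z : R * R => (z.2 < z.1)%R%:R * cumul u z.2).
  apply: bmeasM; last exact: bmeas_snd.
  by apply/bmeas_bool/measurable_fun_ltr; exact: measurable_funTS.
have [mF [K FK]] := bmeas_section_integral (m1 := mu) (m2 := leb) mD mE muD lebE bF.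
split; last by exists K => x Dx; rewrite moment_cumul//; exact: FK.
by apply: eq_measurable_fun mF => x /set_mem Dx; rewrite moment_cumul.
Qed.

(* The bilinear form of the kernel 1 - max(x, s). *)
Definition green u v : R := moment u 1 * I v - I (fun x => v x * moment u x).

Lemma greenE u v : bmeas D u -> bmeas D v ->
  green u v = J (fun t => cumul u t * cumul v t).
Proof. by move=> bu bv; rewrite /green bint_moment// opprB addrCA subrr addr0. Qed.

Lemma green_sym u v : bmeas D u -> bmeas D v -> green u v = green v u.
Proof. by move=> bu bv; rewrite (greenE bu bv) (greenE bv bu); apply: eq_Rintegral => t _; rewrite mulrC. Qed.

Lemma green_ge0 u : bmeas D u -> 0 <= green u u.
Proof. by move=> *; rewrite greenE//; apply: Rintegral_ge0 => t _; rewrite -expr2 sqr_ge0. Qed.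

(* By Cauchy-Schwarz, (cumul u t)^2 <= cumul 1 t * cumul (u^2) t. *)
Lemma green_le u : bmeas D u ->
  green u u <= green (fun=> 1) (fun x => u x ^+ 2).
Proof.
move=> bu; have bu2 := bmeasX 2 bu; have b1 := bm1 1.
have [bP bP1 bP2] := And3 (bmeas_cumul mu bu) (bmeas_cumul mu b1) (bmeas_cumul mu bu2).
rewrite (greenE bu bu) (greenE b1 bu2); apply: le_bint => //; try exact: bmeasM.
move=> t _; rewrite -expr2 /cumul.
rewrite [X in _ <= X * _](_ : _ = I (fun s : R => (s <= t)%R%:R)); last first.
  by apply: eq_Rintegral => s _; rewrite mulr1.
by apply: bint_sqr_le => //; exact: bmeas_le.
Qed.

Lemma moment_ae_eq u v x : bmeas D u -> bmeas D v ->
  {ae mu, forall s, D s -> u s = v s} -> moment u x = moment v x.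
Proof.
move=> bu bv uv; apply: ae_eq_bint => //; try exact: bmeasM.
by apply: filterS uv => s uv Ds; rewrite uv.
Qed.

Lemma momentZ u c x : bmeas D u -> moment (fun s => c * u s) x = c * moment u x.
Proof.
move=> bu; rewrite /moment -bintZ//; last exact: bmeasM.
by apply: eq_Rintegral => s _; ring.
Qed.

Lemma moment1_ge0 x : 0 <= moment (fun=> 1) x.
Proof. by apply: Rintegral_ge0 => s _; rewrite mulr1 le_max lexx orbT. Qed.

Lemma moment1_eq0 x : moment (fun=> 1) x = 0 ->
  {ae mu, forall s, D s -> x <= s}.
Proof.
move=> m0; have b : bmeas D (fun s => Num.max (x - s) 0 * 1) by exact: bmeasM.
have b0 s : D s -> 0 <= Num.max (x - s) 0 * 1 by rewrite mulr1 le_max lexx orbT.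
apply: filterS (bint_eq0 mD muD b b0 m0) => s /= + Ds => /(_ Ds).
by rewrite mulr1 -subr_le0 => <-; rewrite le_max lexx.
Qed.

Lemma moment_eq0 u x : bmeas D u -> moment (fun=> 1) x = 0 -> moment u x = 0.
Proof.
move=> bu /moment1_eq0 h.
have b : bmeas D (fun s => Num.max (x - s) 0 * u s) by exact: bmeasM.
have := ae_eq_bint mD b (bm1 0); rewrite /moment => ->.
  by rewrite Rintegral_cst// mul0r.
by apply: filterS h => s /= xs Ds; rewrite max_r ?mul0r// subr_le0 xs.
Qed.

Lemma moment1_lipschitz x z : x <= z -> moment (fun=> 1) z <= moment (fun=> 1) x + (z - x) * I (fun=> 1).
Proof.
move=> xz; rewrite -bintZ// -bintD//; try exact: bmeasM.
apply: le_bint => //; try exact: bmeasM.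
  by apply: bmeasD; exact: bmeasM.
move=> s _; rewrite !mulr1; case: (leP (z - s) 0); case: (leP (x - s) 0); lra.
Qed.

(** The moment of 1 is convex, and the mass on [L, x] is the slope of a supporting line at x. *)
Lemma moment1_cumul x z : x <= z ->
  moment (fun=> 1) x + (z - x) * cumul (fun=> 1) x <= moment (fun=> 1) z.
Proof.
move=> xz; have bc : bmeas D (fun s => (s <= x)%R%:R * 1 : R).
  by apply: bmeasM => //; exact: bmeas_le.
rewrite -bintZ// -bintD//; [|exact: bmeasM..].
apply: le_bint => //; try exact: bmeasM.
  by apply: bmeasD; exact: bmeasM.
move=> s _; rewrite !mulr1.
by case: (leP (z - s) 0); case: (leP (x - s) 0); case: (leP s x) => /=; lra.
Qed.

(** Only points s <= x contribute, each with x - s <= 1 - L. Hence absence of mass in [L, x] forces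
    a zero moment at x. *)
Lemma moment1_le_cumul x : D x -> moment (fun=> 1) x <= (1 - L) * cumul (fun=> 1) x.
Proof.
rewrite /= in_itv/= => /andP[Lx x1]; have bc : bmeas D (fun s => (s <= x)%R%:R * 1 : R).
  by apply: bmeasM => //; exact: bmeas_le.
rewrite -bintZ//; apply: le_bint => //; try exact: bmeasM.
move=> s; rewrite /= in_itv/= => /andP[Ls s1]; rewrite !mulr1.
by case: (leP (x - s) 0); case: (leP s x) => /=; lra.
Qed.

(* Two points of the level set of the moment leave no mass to the left of the
   smaller one, so that the level is zero; the atom then sits at the supremum
   of the zero set of the moment. *)
Lemma moment1_cst_atom c : (0 < mu D)%E ->
  {ae mu, forall x, D x -> moment (fun=> 1) x = c} ->
  exists2 x0, D x0 & {ae mu, forall x, D x -> x = x0}.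
Proof.
move=> D0 hc; set h := moment (fun=> 1) in hc.
pose Z := D `&` [set x | h x = c].
have [x Zx] : Z !=set0.
  apply/set0P/negP => /eqP Z0; move: D0.
  have/negligibleP -> // : mu.-negligible D; rewrite ?ltxx//.
  apply: negligibleS hc => x Dx /= /(_ Dx) hx.
  by have : Z x by []; rewrite Z0.
have [allx|/existsNP[z /not_implyP[Zz zx]]] := pselect (forall z, Z z -> z = x).
  exists x; first by case: Zx.
  by apply: filterS hc => z hz Dz; apply: allx; split => //; exact: hz.
have c0 : c = 0.
  wlog xz : x z Zx Zz zx / x < z.
    move=> H; have [xz|xz|xz] := ltgtP x z; last by rewrite xz in zx.
    - exact: (H x z).
    - by apply: (H z x) => // /esym.
  have [[Dx hx] [_ hz]] := (Zx, Zz).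
  have := moment1_cumul (ltW xz); rewrite -/h hx hz -subr_ge0 opprD addrA subrr sub0r.
  rewrite oppr_ge0 pmulr_rle0 ?subr_gt0// => P0.
  have := moment1_le_cumul Dx; rewrite -/h hx.
  have := moment1_ge0 x; rewrite -/h hx.
  by move=> c_ge0 c_le; apply/eqP; rewrite eq_le c_ge0 andbT (le_trans c_le)// mulr_ge0_le0 ?subr_ge0.
have hsZ : has_sup Z.
  by split; [exists x|exists 1 => y [+ _]; rewrite /= in_itv/= => /andP[]].
have Dsup : D (sup Z).
  rewrite /= in_itv/=; apply/andP; split.
    have [Dx _] := Zx; move: (Dx); rewrite /= in_itv/= => /andP[Lx _].
    by apply: le_trans Lx _; apply: ub_le_sup => //; case: hsZ.
  by apply: ge_sup => //; [exists x|move=> y [+ _]; rewrite /= in_itv/= => /andP[]].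
(* Points of [Z] come arbitrarily close to the supremum and the moment is zero there; the Lipschitz
   bound carries this to the supremum. *)
have hsup : h (sup Z) = 0.
  apply/eqP; rewrite eq_le moment1_ge0 andbT; apply/ler_addgt0Pl => e e0.
  have I0 : 0 < I (fun=> 1) + 1 by rewrite ltr_wpDl// Rintegral_ge0.
  have [|y Zy yS] := @sup_adherent _ Z (e / (I (fun=> 1) + 1)) _ hsZ; first by rewrite divr_gt0.
  have ySup : y <= sup Z by apply: ub_le_sup => //; case: hsZ.
  apply: le_trans (moment1_lipschitz ySup) _.
  have -> : moment (fun=> 1) y = 0 by have [_ hy] := Zy; rewrite -c0 -hy.
  rewrite add0r addr0.
  have : (sup Z - y) <= e / (I (fun=> 1) + 1) by lra.
  rewrite ler_pdivlMr//; apply: le_trans; rewrite ler_wpM2l ?subr_ge0//; lra.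
(* A zero moment at the supremum puts almost all mass at or to the right of it, and membership in
   [Z] puts it at or to the left. *)
exists (sup Z) => //.
apply: filterS2 hc (moment1_eq0 hsup) => y hy Sy Dy.
apply/eqP; rewrite eq_le Sy// andbT; apply: ub_le_sup; first by case: hsZ.
by split => //; exact: hy.
Qed.

End StringForm.

(** * The energy identity, the bounds on a quasi-eigenvalue and their equality cases *)

(** [U], [V] stand for the integrals of u, v; [hu], [hv] for their moments at 1; [uv] for the
    integral of u times the moment of v, and likewise [uu], [vu], [vv]; [a], [b], [w] for the
    integrals of u^2, v^2, u v. The third hypothesis is the symmetry of the Green form. Equating the
    two expressions of [w] yields the second identity. *)
Lemma energy_algebra {R : numDomainType} (al be c1 c2 U V hu hv uu uv vu vv a b w : R) :
  let p := al ^+ 2 - be ^+ 2 in let q := 2 * al * be in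
  c1 = al * V + be * U + (p * hu - q * hv) ->
  c2 = be * V - al * U + (p * hv + q * hu) ->
  hu * V - vu = hv * U - uv ->
  a = c1 * U + - p * uu + q * uv -> b = c2 * V + - p * vv + - q * vu ->
  w = c2 * U + - p * uv + - q * uu -> w = c1 * V + - p * vu + q * vv ->
  a + b = be * (U ^+ 2 + V ^+ 2) + p * (hu * U - uu + (hv * V - vv)) /\
  al * (U ^+ 2 + V ^+ 2) = q * (hu * U - uu + (hv * V - vv)).
Proof.
move=> p q -> -> S -> -> -> E; have uvE : uv = hv * U - (hu * V - vu) by rewrite S; ring.
split; first by rewrite uvE /p /q; ring.
move/eqP: E; rewrite -subr_eq0 => /eqP E; apply/eqP; rewrite -subr_eq0 -oppr_eq0.
by rewrite -[X in _ == X]E uvE /p /q; apply/eqP; ring.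
Qed.

Section QuasiEigenvalueCore.
Local Set Implicit Arguments.
Local Unset Strict Implicit.
Context {R : realType} (mu : {finite_measure set (measurableTypeR R) -> \bar R}).
Context (L : R) (L1 : L <= 1).
Local Notation D := (`[L, 1%R]%classic : set (measurableTypeR R)).
Local Notation I f := (\int[mu]_(x in D) f x).
Local Notation moment := (moment mu L).
Local Notation green := (green mu L).
Context (alpha beta c1 c2 : R) (u v : R -> R) (bu : bmeas D u) (bv : bmeas D v).
Local Notation p := (alpha ^+ 2 - beta ^+ 2).
Local Notation q := (2 * alpha * beta).
(** With kappa^2 = p + i q, these four hypotheses are the real and imaginary parts of y = c -
    kappa^2 moment y and of y(1) = - i kappa times the integral of y. *)
Hypothesis uE : forall x, D x -> u x = c1 - (p * moment u x - q * moment v x).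
Hypothesis vE : forall x, D x -> v x = c2 - (p * moment v x + q * moment u x).
Hypothesis u1E : u 1 = alpha * I v + beta * I u.
Hypothesis v1E : v 1 = beta * I v - alpha * I u.
Hypothesis uv_neq0 : exists2 x, D x & u x ^+ 2 + v x ^+ 2 != 0.

Local Notation a := (I (fun x => u x ^+ 2) + I (fun x => v x ^+ 2)).
Local Notation W := (I u ^+ 2 + I v ^+ 2).
Local Notation Q := (green u u + green v v).
Local Notation mass := (I (fun=> 1)).
Local Notation smoment := (moment (fun=> 1) 1).
Local Notation one_atom := (exists2 x0, D x0 & {ae mu, forall x, D x -> x = x0}).

Let mD : measurable D. Proof. exact: measurable_itv. Qed.
Let muD : (mu D < +oo)%E.
Proof. by rewrite ltey_eq fin_num_measure. Qed.
Let D1 : D 1. Proof. by rewrite /= in_itv/= L1 lexx. Qed.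
Let b1 c : bmeas D (fun=> c : R). Proof. exact: bmeas_cst. Qed.
Let bu2 := bmeasX 2 bu.
Let bv2 := bmeasX 2 bv.
Let bmu := bmeas_moment mu bu.
Let bmv := bmeas_moment mu bv.

Lemma energy_identity :
  a = beta * W + (alpha ^+ 2 - beta ^+ 2) * Q /\
  alpha * W = 2 * alpha * beta * Q.
Proof.
have lin3 f g h : bmeas D f -> bmeas D g -> bmeas D h -> forall c k l,
    I (fun x => c * f x + k * g x + l * h x) = c * I f + k * I g + l * I h.
  move=> bf bg bh c k l; have [bcf bkg blh] := And3 (bmeasM (b1 c) bf) (bmeasM (b1 k) bg) (bmeasM (b1 l) bh).
  rewrite bintD//; last exact: bmeasD.
  by rewrite bintD// !bintZ.
have buu := bmeasM bu bmu; have buv := bmeasM bu bmv.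
have bvu := bmeasM bv bmu; have bvv := bmeasM bv bmv; have bb := bmeasM bu bv.
(* In each integral the equation replaces one factor; the product u v is expanded twice, through v
   and through u. *)
have Euu : I (fun x => u x ^+ 2) = c1 * I u + (- p) * I (fun x => u x * moment u x)
    + q * I (fun x => u x * moment v x).
  rewrite -lin3//; apply: eq_Rintegral => x /set_mem Dx; rewrite [in LHS]expr2 {2}uE//; ring.
have Evv : I (fun x => v x ^+ 2) = c2 * I v + (- p) * I (fun x => v x * moment v x)
    + (- q) * I (fun x => v x * moment u x).
  rewrite -lin3//; apply: eq_Rintegral => x /set_mem Dx; rewrite [in LHS]expr2 {2}vE//; ring.
have Euv : I (fun x => u x * v x) = c2 * I u + (- p) * I (fun x => u x * moment v x)
    + (- q) * I (fun x => u x * moment u x).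
  rewrite -lin3//; apply: eq_Rintegral => x /set_mem Dx; rewrite [in LHS]vE//; ring.
have Evu : I (fun x => u x * v x) = c1 * I v + (- p) * I (fun x => v x * moment u x)
    + q * I (fun x => v x * moment v x).
  rewrite -lin3//; apply: eq_Rintegral => x /set_mem Dx; rewrite [in LHS]uE//; ring.
have S := green_sym mu L1 bu bv; rewrite /green in S.
have c1E : c1 = alpha * I v + beta * I u + (p * moment u 1 - q * moment v 1).
  by rewrite -u1E (uE D1); ring.
have c2E : c2 = beta * I v - alpha * I u + (p * moment v 1 + q * moment u 1).
  by rewrite -v1E (vE D1); ring.
exact: energy_algebra c1E c2E S Euu Evv Euv Evu.
Qed.

Let a_ge0 : 0 <= a.
Proof. by rewrite addr_ge0// Rintegral_ge0// => x _; rewrite sqr_ge0. Qed.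

Let W_ge0 : 0 <= W. Proof. by rewrite addr_ge0// sqr_ge0. Qed.

Let Q_ge0 : 0 <= Q. Proof. by rewrite addr_ge0// green_ge0. Qed.

Let mass_ge0 : 0 <= mass. Proof. exact: Rintegral_ge0. Qed.

Let bint_sqr f : bmeas D f -> I f ^+ 2 <= mass * I (fun x => f x ^+ 2).
Proof.
move=> bf; rewrite (_ : I f = I (fun x => 1 * f x)); last first.
  by apply: eq_Rintegral => x _; rewrite mul1r.
rewrite (_ : I (fun x => f x ^+ 2) = I (fun x => 1 * f x ^+ 2)); last first.
  by apply: eq_Rintegral => x _; rewrite mul1r.
exact: bint_sqr_le.
Qed.

Let W_le : W <= mass * a. Proof. by rewrite mulrDr lerD ?bint_sqr. Qed.

(** The part of the Green form of 1 and |y|^2 that the bound Q <= Stm a discards. It is kept because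
    equality in the bound forces K = 0. *)
Local Notation K := (I (fun x => (u x ^+ 2 + v x ^+ 2) * moment (fun=> 1) x)).

Let K_ge0 : 0 <= K.
Proof.
by apply: Rintegral_ge0 => x _; rewrite mulr_ge0 ?moment1_ge0// addr_ge0 ?sqr_ge0.
Qed.

Let bm1 : bmeas D (moment (fun=> 1)). Proof. exact: bmeas_moment. Qed.

Let Q_le : Q <= smoment * a - K.
Proof.
apply: le_trans (lerD (green_le mu L1 bu) (green_le mu L1 bv)) _.
rewrite /green.
rewrite (_ : K = I (fun x => u x ^+ 2 * moment (fun=> 1) x)
    + I (fun x => v x ^+ 2 * moment (fun=> 1) x)); first by lra.
rewrite -bintD//; try exact: bmeasM.
by apply: eq_Rintegral => x _; ring.
Qed.

Let ae_zero (f : R -> R) : bmeas D f -> I (fun x => f x ^+ 2) = 0 ->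
  {ae mu, forall x, D x -> f x = 0}.
Proof.
move=> bf f0; have := bint_eq0 mD muD (bmeasX 2 bf) (fun x _ => sqr_ge0 (f x)) f0.
by apply: filterS => x /= + Dx => /(_ Dx)/eqP; rewrite sqrf_eq0 => /eqP.
Qed.

Let ae_moment0 (f : R -> R) x : bmeas D f ->
  {ae mu, forall x, D x -> f x = 0} -> moment f x = 0.
Proof.
move=> bf f0; rewrite (moment_ae_eq _ bf (b1 0) f0).
by rewrite /moment; under eq_Rintegral do rewrite mulr0; rewrite Rintegral_cst// mul0r.
Qed.

(** If y vanished almost everywhere, so would its moments, and y would equal c on all of [D]; the
    condition at 1 then gives c = 0, against [uv_neq0]. *)
Let a_gt0 : 0 < a.
Proof.
rewrite lt_neqAle a_ge0 andbT eq_sym; apply/negP => /eqP a0.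
have Iu2 : 0 <= I (fun x => u x ^+ 2) by apply: Rintegral_ge0 => x _; exact: sqr_ge0.
have Iv2 : 0 <= I (fun x => v x ^+ 2) by apply: Rintegral_ge0 => x _; exact: sqr_ge0.
have u0 : {ae mu, forall x, D x -> u x = 0} by apply: ae_zero => //; lra.
have v0 : {ae mu, forall x, D x -> v x = 0} by apply: ae_zero => //; lra.
have Iu : I u = 0 by rewrite (ae_eq_bint mD bu (b1 0) u0) Rintegral_cst// mul0r.
have Iv : I v = 0 by rewrite (ae_eq_bint mD bv (b1 0) v0) Rintegral_cst// mul0r.
have uc x : D x -> u x = c1 by move=> /uE ->; rewrite !ae_moment0//; ring.
have vc x : D x -> v x = c2 by move=> /vE ->; rewrite !ae_moment0//; ring.
have [x Dx /eqP] := uv_neq0; apply.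
rewrite uc// vc// -(uc 1)// -(vc 1)// u1E v1E Iu Iv; ring.
Qed.

Let mass_gt0 : 0 < mass.
Proof.
rewrite lt_neqAle mass_ge0 andbT eq_sym; apply/negP => /eqP m0.
have D0 : {ae mu, forall x, D x -> (1 : R) = 0}.
  by apply: bint_eq0 => // x _; exact: ler01.
have I0 f : bmeas D f -> I f = 0.
  move=> bf; rewrite (ae_eq_bint mD bf (b1 0)) ?Rintegral_cst ?mul0r//.
  by apply: filterS D0 => x + Dx => /(_ Dx)/eqP; rewrite oner_eq0.
by have := a_gt0; rewrite !I0// addr0 ltxx.
Qed.

Let muD_gt0 : (0 < mu D)%E.
Proof.
have := mass_gt0; rewrite Rintegral_cst// mul1r.
apply: contraTT; rewrite -leNgt measure_le0 => /eqP D0.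
by rewrite [X in fine X](D0 : _ = 0%E) ltxx.
Qed.

Local Notation nu := (alpha ^+ 2 + beta ^+ 2).

(** Dividing the second identity by [alpha] gives W, and substitution in the first gives a.
    Comparison with W >= 0, Q <= Stm a and W <= Tm a then produces the bounds. *)
Let alpha_neq0_energy : alpha != 0 -> W = 2 * beta * Q /\ a = nu * Q.
Proof.
move=> a0; move: energy_identity; move: (W) (Q) (a) => w z b [-> E2].
have -> : w = 2 * beta * z by apply: (mulfI a0); rewrite E2; ring.
by split=> //; ring.
Qed.

Lemma quasi_eigenvalue_bounds : alpha != 0 ->
  [/\ 0 <= beta, 1 <= smoment * nu & 2 * beta <= mass * nu].
Proof.
move=> /alpha_neq0_energy [WE aE].
have nu_ge0 : 0 <= nu by rewrite addr_ge0// sqr_ge0.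
have Q_gt0 : 0 < Q.
  rewrite lt_neqAle Q_ge0 andbT eq_sym; apply/negP => /eqP Q0.
  by have := a_gt0; rewrite aE Q0 mulr0 ltxx.
split.
- by have := W_ge0; rewrite WE pmulr_lge0// pmulr_rge0.
- rewrite -(ler_pM2r a_gt0) mul1r [leLHS]aE [smoment * _]mulrC -mulrA ler_wpM2l//.
  by apply: le_trans Q_le _; rewrite gerBl.
- by have := W_le; rewrite WE aE mulrA ler_pM2r.
Qed.

(** At [alpha] = 0 the energy identity reads a = beta W - beta^2 Q, so that a <= beta W <= beta Tm
    a. *)
Lemma imaginary_quasi_eigenvalue_bound : alpha = 0 -> 0 < beta /\ 1 <= beta * mass.
Proof.
move=> a0; have [E1 _] := energy_identity; rewrite a0 in E1.
have aW : a <= beta * W.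
  by rewrite E1 expr0n sub0r mulNr gerBl mulr_ge0// sqr_ge0.
have b0 : 0 < beta.
  have := lt_le_trans a_gt0 aW; have [//|b0] := ltP 0 beta.
  by rewrite ltNge mulr_le0_ge0.
split => //; rewrite -(ler_pM2r a_gt0) mul1r (le_trans aW)// -mulrA.
by rewrite ler_wpM2l// ltW.
Qed.

(** Equality makes y almost everywhere a constant k, nonzero since W > 0. The equation becomes k = c
    - kappa^2 k h(x) with h the moment of 1, and this fixes the value of h(x). *)
Let cauchy_schwarz_atom : beta != 0 -> W = mass * a -> one_atom.
Proof.
move=> b0 E.
have Wu := bint_sqr bu; have Wv := bint_sqr bv; rewrite mulrDr in E.
have cst f : bmeas D f -> I f ^+ 2 = mass * I (fun x => f x ^+ 2) ->
    {ae mu, forall x, D x -> f x = I f / mass}.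
  move=> bf /(bint_sqr_eq mD muD bf); apply: filterS => x /= fx Dx.
  by rewrite -(fx Dx) mulrC mulKf// gt_eqF.
have uc : {ae mu, forall x, D x -> u x = I u / mass} by apply: cst => //; lra.
have vc : {ae mu, forall x, D x -> v x = I v / mass} by apply: cst => //; lra.
set k1 := I u / mass in uc; set k2 := I v / mass in vc.
have momu x : moment u x = k1 * moment (fun=> 1) x.
  by rewrite (moment_ae_eq x bu (b1 k1) uc) -momentZ//; congr (moment _ _); apply/funext => y; rewrite mulr1.
have momv x : moment v x = k2 * moment (fun=> 1) x.
  by rewrite (moment_ae_eq x bv (b1 k2) vc) -momentZ//; congr (moment _ _); apply/funext => y; rewrite mulr1.
(* A1 + i A2 = kappa^2 k. Multiplying c - k = kappa^2 k h by its conjugate and taking real parts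
   solves for the real number h. *)
pose A1 := p * k1 - q * k2; pose A2 := p * k2 + q * k1.
have A0 : A1 ^+ 2 + A2 ^+ 2 != 0.
  rewrite (_ : _ + _ = nu ^+ 2 * (k1 ^+ 2 + k2 ^+ 2)); last by rewrite /A1 /A2; ring.
  rewrite mulf_neq0//.
    by rewrite sqrf_eq0 gt_eqF// ltr_wpDl ?sqr_ge0// exprn_even_gt0.
  rewrite /k1 /k2 !expr_div_n -mulrDl mulf_neq0 ?invr_eq0 ?sqrf_eq0 ?(gt_eqF mass_gt0)//.
  by rewrite E -mulrDr gt_eqF// mulr_gt0.
apply: (moment1_cst_atom (c := ((c1 - k1) * A1 + (c2 - k2) * A2) / (A1 ^+ 2 + A2 ^+ 2)) L1 muD_gt0).
apply: filterS2 uc vc => x ux vx Dx.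
have Ux : k1 = c1 - A1 * moment (fun=> 1) x.
  by rewrite -{1}(ux Dx) uE// momu momv /A1; ring.
have Vx : k2 = c2 - A2 * moment (fun=> 1) x.
  by rewrite -{1}(vx Dx) vE// momu momv /A2; ring.
apply: (mulIf A0); rewrite divfK//.
rewrite {1}Ux {1}Vx; ring.
Qed.

Lemma mass_bound_atom : alpha != 0 -> beta != 0 -> 2 * beta = mass * nu -> one_atom.
Proof.
move=> /alpha_neq0_energy [WE aE] b0 E; apply: cauchy_schwarz_atom => //.
by rewrite WE aE E mulrA.
Qed.

Lemma imaginary_bound_atom : alpha = 0 -> beta * mass = 1 -> one_atom.
Proof.
move=> a0 bm; have [b0 _] := imaginary_quasi_eigenvalue_bound a0.
apply: cauchy_schwarz_atom; first by rewrite gt_eqF.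
have [E1 _] := energy_identity; rewrite a0 in E1.
apply/eqP; rewrite eq_le W_le/= -(ler_pM2l b0) mulrA bm mul1r.
by rewrite E1 expr0n sub0r mulNr gerBl mulr_ge0// sqr_ge0.
Qed.

(** Equality gives K = 0: almost everywhere y = 0 or the moment h of 1 is zero. Where h = 0 the
    moment of y vanishes too and y = c. So y = c w almost everywhere, w being the indicator of h =
    0, and |y|^2 = |c|^2 |1 - kappa^2 moment w|^2. As kappa^2 is not real, this is never zero, hence
    h = 0 almost everywhere. *)
Lemma moment_bound_atom : alpha != 0 -> beta != 0 -> smoment * nu = 1 -> one_atom.
Proof.
move=> a0 b0 E; have [WE aE] := alpha_neq0_energy a0.
have nu0 : 0 < nu by rewrite ltr_wpDl ?sqr_ge0// exprn_even_gt0.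
have K0 : K = 0.
  apply/eqP; rewrite eq_le K_ge0 andbT.
  have : nu * Q <= nu * (smoment * a - K) by rewrite ler_pM2l.
  by rewrite -aE mulrBr mulrA [nu * _]mulrC E mul1r lerBrDl gerDr pmulr_rle0.
have bK : bmeas D (fun x => (u x ^+ 2 + v x ^+ 2) * moment (fun=> 1) x).
  by apply: bmeasM => //; exact: bmeasD.
have {K0} aeK : {ae mu, forall x, D x -> (u x ^+ 2 + v x ^+ 2) * moment (fun=> 1) x = 0}.
  apply: (bint_eq0 mD muD bK _ K0) => x _.
  by rewrite mulr_ge0 ?moment1_ge0// addr_ge0 ?sqr_ge0.
have left_cst x : D x -> moment (fun=> 1) x = 0 -> u x = c1 /\ v x = c2.
  move=> Dx h0; rewrite (uE Dx) (vE Dx) (moment_eq0 bu h0) (moment_eq0 bv h0).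
  by rewrite !mulr0 subrr addr0 !subr0.
(* As the moment of 1 is nonnegative, the inequality singles out its zeros. *)
pose w x : R := (moment (fun=> 1) x <= 0)%R%:R.
have bw : bmeas D w by apply: bmeas_le; [case: bm1|exact: measurable_cst].
have aew : {ae mu, forall x, D x -> u x = c1 * w x /\ v x = c2 * w x}.
  apply: filterS aeK => x /= + Dx => /(_ Dx)/eqP.
  rewrite mulf_eq0 paddr_eq0 ?sqr_ge0// !sqrf_eq0 /w => /orP[/andP[/eqP u0 /eqP v0]|/eqP h0].
    case: leP => [h0|_]; last by rewrite u0 v0 !mulr0.
    have {}h0 : moment (fun=> 1) x = 0 by apply/eqP; rewrite eq_le h0 moment1_ge0.
    by rewrite !mulr1; exact: left_cst.
  by rewrite h0 lexx !mulr1; exact: left_cst.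
have momu x : moment u x = c1 * moment w x.
  rewrite -momentZ//; apply: moment_ae_eq => //; first exact: bmeasM.
  by apply: filterS aew => y H Dy; case: (H Dy).
have momv x : moment v x = c2 * moment w x.
  rewrite -momentZ//; apply: moment_ae_eq => //; first exact: bmeasM.
  by apply: filterS aew => y H Dy; case: (H Dy).
have uvE x : D x -> u x ^+ 2 + v x ^+ 2 = (c1 ^+ 2 + c2 ^+ 2) *
    ((1 - p * moment w x) ^+ 2 + (q * moment w x) ^+ 2).
  by move=> Dx; rewrite uE// vE// momu momv; ring.
have c0 : c1 ^+ 2 + c2 ^+ 2 != 0.
  have [x Dx] := uv_neq0; rewrite uvE//; apply: contraNneq => ->.
  by rewrite mul0r.
apply: (moment1_cst_atom (c := 0) L1 muD_gt0).
apply: filterS aeK => x /= + Dx => /(_ Dx)/eqP; rewrite uvE//.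
rewrite -mulrA mulf_eq0 (negbTE c0)/= mulf_eq0 => /orP[|/eqP//].
rewrite paddr_eq0 ?sqr_ge0// !sqrf_eq0 !mulf_eq0 pnatr_eq0 (negbTE a0) (negbTE b0)/=.
by move=> /andP[+ /eqP w0]; rewrite w0 mulr0 subr0 oner_eq0.
Qed.

End QuasiEigenvalueCore.

(** * Reduction of a regular string to a finite measure on an interval *)

(** Restriction to the whole space leaves the values unchanged and carries the finite structure;
    equality as measures allows [M] to be substituted. *)
Lemma finite_measureP d (T : measurableType d) (R : realType)
    (M : {measure set T -> \bar R}) :
  (M setT < +oo)%E ->
  exists mu : {finite_measure set T -> \bar R}, mu = M :> {measure set T -> \bar R}.
Proof.
move=> MT; exists (mfrestr measurableT MT); apply: eq_measure.
by apply/funext => A; rewrite /= /mfrestr /mrestr setIT.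
Qed.

Section StringSupport.
Local Set Implicit Arguments.
Local Unset Strict Implicit.
Context {R : realType}.
Implicit Types (M : {measure set (measurableTypeR R) -> \bar R}) (A B : set R).

(** A point left of [l] is outside the support, so a null interval with rational ends surrounds it,
    and there are countably many such intervals. *)
Lemma null_left_supp M l : lbound (supp M) l -> M `]-oo, l[%classic = 0%E.
Proof.
move=> lM.
(* [F n] is the rational interval coded by n if that interval is null, and empty otherwise. *)
pose F (n : nat) : set R := if unpickle n is Some (a, b) then
  [set x | M `]ratr a, ratr b[%classic = 0%E /\ `]ratr a, ratr b[%classic x]
  else set0.
have F0 n : M.-negligible (F n).
  rewrite /F; case: unpickle => [[a b]|]; last exact: negligible_set0.
  have [M0|M0] := pselect (M `]ratr a, ratr b[%classic = 0%E).
    by exists `]ratr a, ratr b[%classic; split => // x [].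
  by apply: negligibleS (negligible_set0 M) => x [].
apply: measure_negligible; first exact: measurable_itv.
apply: negligibleS (negligible_bigcup F0) => x; rewrite /= in_itv/= => xl.
have : ~ supp M x by move=> /lM; rewrite leNgt xl.
move=> /existsNP[U] /not_implyP[oU] /not_implyP[Ux] /negP.
rewrite lt0e measure_ge0 andbT negbK => /eqP MU0.
have [e /= e0 eU] : nbhs (x : R) U by apply: open_nbhs_nbhs; split.
have [a] : exists a : rat, ratr a \in `]x - e, x[ by apply: rat_in_itvoo; lra.
have [b] : exists b : rat, ratr b \in `]x, x + e[ by apply: rat_in_itvoo; lra.
rewrite !in_itv/= => /andP[xb be] /andP[ea ax].
exists (pickle (a, b)); first exact: I.
rewrite /F pickleK; split; last by rewrite /= in_itv/= xb ax.
apply/eqP; rewrite -measure_le0 -MU0 le_measure ?inE//; first exact: open_measurable.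
move=> z; rewrite /= in_itv/= => /andP[az zb]; apply: eU.
by rewrite /= ltr_norml; apply/andP; split; lra.
Qed.

(** [x] will be a point where the eigenfunction is nonzero. It may lie left of the support, so the
    interval is extended down to it. *)
Lemma regular_string_carrier M x : regular_string M -> x <= 1 ->
  exists2 L, L <= x & M (~` `[L, 1%R]%classic) = 0%E.
Proof.
move=> [[M1 _] [l lM]] x1; exists (Num.min l x); first by rewrite ge_min lexx orbT.
apply: measure_negligible; first by apply: measurableC; exact: measurable_itv.
have N1 : M.-negligible `]1%R, +oo[%classic by exists `]1%R, +oo[%classic; split => //; exact: measurable_itv.
have N2 : M.-negligible `]-oo, l[%classic.
  by exists `]-oo, l[%classic; split; [exact: measurable_itv|exact: null_left_supp|].
apply: negligibleS (negligibleU N1 N2) => z /=.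
rewrite !in_itv/= => /negP; rewrite negb_and -!ltNge lt_min andbT => /orP[/andP[zl _]|z1].
  by right.
by left.
Qed.

Lemma Rintegral_carrier M A B (f : R -> R) : measurable (A : set (measurableTypeR R)) ->
  measurable (B : set (measurableTypeR R)) -> M (~` B) = 0%E -> measurable_fun A f ->
  \int[M]_(x in A) f x = \int[M]_(x in A `&` B) f x.
Proof.
move=> mA mB MB mf; rewrite Rintegral_mkcondr; congr fine.
apply: ae_eq_integral => //.
- exact/measurable_EFinP.
- by apply/measurable_EFinP/measurable_restrict => //; exact: measurable_funS mf.
- exists (~` B); split => //; first exact: measurableC.
  move=> x /= /not_implyP[Ax + Bx]; apply.
  by rewrite patchE mem_set.
Qed.

End StringSupport.

(** * The eigenvalue problem in real form on the interval *)

Section StringSolution.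
Local Set Implicit Arguments.
Local Unset Strict Implicit.
Context {R : realType} (mu : {finite_measure set (measurableTypeR R) -> \bar R}).
Context (L : R) (L1 : L <= 1).
Local Notation D := (`[L, 1%R]%classic : set (measurableTypeR R)).
Hypothesis muD : mu (~` D) = 0%E.
Local Notation I f := (\int[mu]_(x in D) f x).
Local Notation moment := (moment mu L).
Implicit Types (u v : R -> R) (x : R).

Let mD : measurable D. Proof. exact: measurable_itv. Qed.
Let muDoo : (mu D < +oo)%E.
Proof. by rewrite ltey_eq fin_num_measure. Qed.
Let D1 : D 1. Proof. by rewrite /= in_itv/= L1 lexx. Qed.

Lemma left_integral_moment u x : D x -> measurable_fun (`]-oo, 1%R]%classic : set (measurableTypeR R)) u ->
  \int[mu]_(s in `]-oo, x]) ((x - s) * u s) = moment u x.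
Proof.
move=> Dx mu1; have Dx' := Dx; rewrite /= in_itv/= in Dx'; have [Lx x1] := andP Dx'.
rewrite (Rintegral_carrier _ mD muD)//.
  rewrite setIC Rintegral_mkcondr; apply: eq_Rintegral => s _.
  rewrite patchE mem_setE in_itv/=; case: leP => sx.
    by rewrite max_l// subr_ge0.
  by rewrite max_r ?mul0r// subr_le0 ltW.
apply: measurable_funM; first exact: measurable_funB.
apply: measurable_funS mu1 => // s; rewrite /= !in_itv/= => sx.
exact: le_trans sx x1.
Qed.

Lemma left_integral u : measurable_fun (`]-oo, 1%R]%classic : set (measurableTypeR R)) u ->
  \int[mu]_(s in `]-oo, 1]) u s = I u.
Proof.
move=> mu1; rewrite (Rintegral_carrier _ mD muD)//; congr (Rintegral _ _ _).
by apply/seteqP; split=> [x []//|x /=]; rewrite !in_itv/= => /andP[-> ->].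
Qed.

Lemma moment_bounded u : mu.-integrable D (EFin \o u) ->
  exists K, forall x, D x -> `|moment u x| <= K.
Proof.
move=> iu; exists ((1 - L) * I (fun s => `|u s|)) => x.
rewrite /= in_itv/= => /andP[Lx x1].
have bk : bmeas D (fun s => Num.max (x - s) 0).
  apply: bmeas_max; last exact: bmeas_cst.
  by apply: bmeasB; [exact: bmeas_cst|exact: bmeas_id].
have ik := bmeas_integrableM mD bk iu.
have iau : mu.-integrable D (EFin \o (fun s => `|u s|)) by exact: integrable_norm iu.
apply: le_trans (le_normr_Rintegral mD ik) _.
rewrite -RintegralZl//; apply: le_Rintegral => //.
- exact: integrable_norm ik.
- by apply: bmeas_integrableM => //; exact: bmeas_cst.
move=> s; rewrite /= in_itv/= => /andP[Ls s1]; rewrite normrM ler_wpM2r//.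
by rewrite ger0_norm ?le_max ?lexx ?orbT// ge_max; apply/andP; split; lra.
Qed.

Lemma string_solution_data (alpha beta : R) (y : R -> R[i]) :
  let u := fun x => complex.Re (y x) in let v := fun x => complex.Im (y x) in
  let p := alpha ^+ 2 - beta ^+ 2 in let q := 2 * alpha * beta in
  let kappa := (alpha +i* beta)%C in
  string_solution mu kappa y -> kappa != 0 ->
  y 1 = 'i%C / kappa * right_derivative_at1 mu kappa y ->
  [/\ bmeas D u, bmeas D v, u 1 = alpha * I v + beta * I u,
    v 1 = beta * I v - alpha * I u &
    exists c1 c2, (forall x, D x -> u x = c1 - (p * moment u x - q * moment v x)) /\
      (forall x, D x -> v x = c2 - (p * moment v x + q * moment u x))].
Proof.
move=> u v p q kappa [[iu iv] [[c1 c2] yE]] k0 y1.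
have mu1 : measurable_fun (`]-oo, 1%R]%classic : set (measurableTypeR R)) u.
  by apply/measurable_EFinP; exact: measurable_int iu.
have mv1 : measurable_fun (`]-oo, 1%R]%classic : set (measurableTypeR R)) v.
  by apply/measurable_EFinP; exact: measurable_int iv.
have D_le1 : D `<=` `]-oo, 1%R]%classic by move=> x; rewrite /= !in_itv/= => /andP[].
have eq x : D x -> y x = (c1 +i* c2)%C - kappa ^+ 2 * (moment u x +i* moment v x)%C.
  move=> Dx; have x1 : x <= 1 by have := D_le1 _ Dx; rewrite /= in_itv.
  rewrite yE//; congr (_ - _ * _); rewrite /Cintegral; congr (_ +i* _)%C.
    rewrite -left_integral_moment//; apply: eq_Rintegral => s _.
    by rewrite /u /=; case: (y s) => a b /=; rewrite mul0r subr0.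
  rewrite -left_integral_moment//; apply: eq_Rintegral => s _.
  by rewrite /v /=; case: (y s) => a b /=; rewrite mul0r addr0.
have uE x : D x -> u x = c1 - (p * moment u x - q * moment v x).
  by move=> /eq; rewrite /u /= => ->; rewrite expr2 /= /p /q; ring.
have vE x : D x -> v x = c2 - (p * moment v x + q * moment u x).
  by move=> /eq; rewrite /v /= => ->; rewrite expr2 /= /p /q; ring.
(* The equation expresses u and v through moments, which are bounded for integrable functions;
   integrability thus improves to boundedness on [D]. *)
have bdd w a r s : measurable_fun (`]-oo, 1%R]%classic : set (measurableTypeR R)) w ->
    (forall x, D x -> w x = a - (r * moment u x + s * moment v x)) -> bmeas D w.
  move=> mw wE; split; first exact: measurable_funS mw.
  have iDu : mu.-integrable D (EFin \o u) by exact: integrableS iu.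
  have iDv : mu.-integrable D (EFin \o v) by exact: integrableS iv.
  have [K uK] := moment_bounded iDu; have [K' vK] := moment_bounded iDv.
  exists (`|a| + (`|r| * K + `|s| * K')) => x Dx; rewrite wE//.
  rewrite (le_trans (ler_normB _ _))// lerD2l (le_trans (ler_normD _ _))//.
  by rewrite !normrM lerD// ler_wpM2l ?uK ?vK.
have y1' : y 1 = - 'i%C * kappa * (I u +i* I v)%C.
  rewrite y1 /right_derivative_at1 /Cintegral !left_integral// -/u -/v.
  by field.
split.
- by apply: (bdd u c1 p (- q)) => // x Dx; rewrite mulNr uE.
- by apply: (bdd v c2 q p) => // x Dx; rewrite vE// [q * _ + _]addrC.
- by rewrite /u /= y1' /=; ring.
- by rewrite /v /= y1' /=; ring.
- by exists c1, c2.
Qed.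

End StringSolution.

(** * Bounds for admissible strings *)

Section StringBounds.
Local Set Implicit Arguments.
Local Unset Strict Implicit.
Context {R : realType}.
Implicit Types (M : {measure set (measurableTypeR R) -> \bar R}).

Lemma one_atom_point_mass (mu : {finite_measure set (measurableTypeR R) -> \bar R})
    (L x0 : R) :
  let D : set (measurableTypeR R) := `[L, 1%R]%classic in
  mu (~` D) = 0%E -> (0 < mu D)%E -> D x0 -> {ae mu, forall x, D x -> x = x0} ->
  exists A, is_point_mass mu x0 A.
Proof.
move=> D muD D0 Dx0 ae0.
have mD : measurable D by exact: measurable_itv.
have m1 : measurable ([set x0] : set (measurableTypeR R)) by exact: measurable_set1.
have N0 : mu.-negligible (~` [set x0]).
  have ND : mu.-negligible (~` D) by exists (~` D); split => //; exact: measurableC.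
  apply: negligibleS (negligibleU ND ae0) => x /= xx0.
  by have [Dx|] := pselect (D x); [right=> H; apply: xx0; exact: H|left].
have mu1 : mu (~` [set x0]) = 0%E.
  by apply: measure_negligible => //; exact: measurableC.
have muB (B : set (measurableTypeR R)) : measurable B ->
    mu B = ((fine (mu [set x0]))%:E * \d_(x0 : measurableTypeR R) B)%E.
  move=> mB; rewrite diracE fineK; last exact: fin_num_measure.
  have BD0 : mu (B `\` [set x0]) = 0%E.
    apply: (subset_measure0 _ _ _ mu1); [exact: measurableD|exact: measurableC|].
    by move=> x [].
  have [/set_mem Bx0|Bx0] := boolP (x0 \in B); rewrite ?mule1 ?mule0.
    rewrite -[in LHS](setDUK (A := [set x0]) (B := B)); last by move=> _ ->.
    by apply: measureU0 => //; exact: measurableD.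
  rewrite -BD0; congr (mu _); apply/seteqP; split => [x Bx|x []//]; split => // xx0.
  by move: Bx0; rewrite -xx0 mem_set.
have A0 : 0 < fine (mu [set x0]).
  move: D0; rewrite (muB _ mD) diracE mem_set// mule1 lte_fin.
  by [].
exists (fine (mu [set x0])); split => //.
by move: Dx0; rewrite /D /= in_itv/= => /andP[].
Qed.

(** The mass and the moment on [[L, 1]] are at most m and S. Equality in a bound stated with m or S
    is squeezed onto the one stated with the actual mass or moment, so the equality cases above
    apply. *)
Lemma string_bounds (m S alpha beta : R) M :
  let nu := alpha ^+ 2 + beta ^+ 2 in
  Ad m S M -> quasi_eigenvalues M (alpha +i* beta)%C ->
  (alpha != 0 -> [/\ 0 <= beta, 1 <= S * nu, 2 * beta <= m * nu &
     beta != 0 -> S * nu = 1 \/ 2 * beta = m * nu ->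
     exists x0 A, is_point_mass M x0 A]) /\
  (alpha = 0 -> [/\ 0 < beta, 1 <= beta * m &
     beta * m = 1 -> exists x0 A, is_point_mass M x0 A]).
Proof.
move=> nu [regM [Tm0 Tmm] [Stm0 StmS]] [k0 [y [sol [x x1 yx] y1]]].
have [L Lx ML] := regular_string_carrier regM x1.
have L1 := le_trans Lx x1.
set D : set (measurableTypeR R) := `[L, 1%R]%classic in ML.
have mD : measurable D by exact: measurable_itv.
have MT : M setT = M D.
  by rewrite -(setUv D); apply: measureU0 => //; exact: measurableC.
have [mu muM] : exists mu : {finite_measure set (measurableTypeR R) -> \bar R},
    mu = M :> {measure set (measurableTypeR R) -> \bar R}.
  by apply: finite_measureP; rewrite MT; case: regM => -[_ +] _; apply.
subst M.
have massE : \int[mu]_(x in D) 1 = fine (mu D) by rewrite Rintegral_cst// mul1r.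
have finD : mu D \is a fin_num by exact: fin_num_measure.
have le_mass : \int[mu]_(x in D) 1 <= m.
  rewrite massE -lee_fin fineK//; apply: le_trans Tmm.
  apply: le_measure; rewrite ?inE//.
  by move=> z; rewrite /D /= !in_itv/= => /andP[].
have muD0 : (0 < mu D)%E.
  by apply: lt_le_trans Tm0 _; rewrite -MT; apply: le_measure; rewrite ?inE.
have le_smoment : moment mu L (fun=> 1) 1 <= S.
  rewrite -(left_integral_moment ML)//; last by rewrite /= in_itv/= L1 lexx.
  rewrite (_ : Rintegral _ _ _ = fine (Stm mu)).
    by rewrite -lee_fin fineK// ge0_fin_numE// (le_lt_trans StmS)// ltry.
  by congr fine; apply: eq_integral => s _; rewrite mulr1.
have [bu bv u1 v1 [c1 [c2 [uE vE]]]] := string_solution_data ML sol k0 y1.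
have uv0 : exists2 x, D x & complex.Re (y x) ^+ 2 + complex.Im (y x) ^+ 2 != 0.
  exists x; first by rewrite /D /= in_itv/= Lx x1.
  apply: contra yx; rewrite paddr_eq0 ?sqr_ge0// !sqrf_eq0 => /andP[a b].
  by rewrite eq_complex a b.
have atom : (exists2 x0, D x0 & {ae mu, forall x, D x -> x = x0}) ->
    exists x0 A, is_point_mass mu x0 A.
  by move=> [x0 Dx0 /(one_atom_point_mass ML muD0 Dx0)[A MA]]; exists x0, A.
have nu_ge0 : 0 <= nu by rewrite addr_ge0// sqr_ge0.
split=> a0.
  have [b0 b1 b2] := quasi_eigenvalue_bounds L1 bu bv uE vE u1 v1 uv0 a0.
  have b1' : moment mu L (fun=> 1) 1 * nu <= S * nu by rewrite ler_wpM2r.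
  have b2' : \int[mu]_(x in D) 1 * nu <= m * nu by rewrite ler_wpM2r.
  split => //; [exact: le_trans b1 b1'|exact: le_trans b2 b2'|].
  move=> bn0 [E|E]; apply: atom.
    apply: (moment_bound_atom L1 bu bv uE vE u1 v1 uv0 a0 bn0).
    by apply/eqP; rewrite eq_le b1 andbT (le_trans b1')// E.
  apply: (mass_bound_atom L1 bu bv uE vE u1 v1 uv0 a0 bn0).
  by apply/eqP; rewrite eq_le b2 E b2'.
have [b0 b1] := imaginary_quasi_eigenvalue_bound L1 bu bv uE vE u1 v1 uv0 a0.
have b1' : beta * \int[mu]_(x in D) 1 <= beta * m by rewrite ler_pM2l.
split => //; first exact: le_trans b1 b1'.
move=> E; apply: atom.
apply: (imaginary_bound_atom L1 bu bv uE vE u1 v1 uv0 a0).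
by apply/eqP; rewrite eq_le b1 andbT (le_trans b1')// E.
Qed.

End StringBounds.

(** * Strings with a single atom *)

Section PointMass.
Local Set Implicit Arguments.
Local Unset Strict Implicit.
Context {R : realType}.
Implicit Types (M : {measure set (measurableTypeR R) -> \bar R}) (B : set (measurableTypeR R)).

Section PointMassIntegral.
Context M (x0 A : R) (MA : is_point_mass M x0 A).

Let x0_le1 : x0 <= 1. Proof. by case: MA. Qed.
Let A_gt0 : 0 < A. Proof. by case: MA. Qed.
Let ME B : measurable B -> M B = (A * (x0 \in B)%:R)%:E.
Proof. by case: MA => _ _ h mB; rewrite h// diracE EFinM. Qed.

Lemma integral_point_mass B (g : R -> R) : measurable B -> measurable_fun B g ->
  (\int[M]_(x in B) (g x)%:E = (A * (x0 \in B)%:R * g x0)%:E)%E.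
Proof.
move=> mB mg; rewrite (ae_eq_integral (cst (g x0)%:E))//.
- by rewrite integral_cst// ME// -EFinM mulrC.
- exact/measurable_EFinP.
- exists (~` [set x0]); split; first by apply: measurableC; exact: measurable_set1.
    rewrite ME; last by apply: measurableC; exact: measurable_set1.
    by rewrite memNset ?mulr0//= => /(_ erefl).
  by move=> x /= /not_implyP[_ gx] xx0; apply: gx; rewrite xx0.
Qed.

Lemma Rintegral_point_mass B (g : R -> R) : measurable B -> measurable_fun B g ->
  \int[M]_(x in B) g x = A * (x0 \in B)%:R * g x0.
Proof. by move=> mB mg; rewrite /Rintegral integral_point_mass. Qed.

Lemma Tm_point_mass : Tm M = A%:E.
Proof. by rewrite /Tm ME// mem_set ?mulr1//= in_itv. Qed.

Lemma Stm_point_mass : Stm M = (A * (1 - x0))%:E.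
Proof.
rewrite /Stm integral_point_mass//; last exact: measurable_funB.
by rewrite mem_set ?mulr1//= in_itv.
Qed.

Lemma Cintegral_point_mass (y : R -> R[i]) x : x <= 1 ->
  measurable_fun (`]-oo, 1%R]%classic : set (measurableTypeR R)) (fun s => complex.Re (y s)) ->
  measurable_fun (`]-oo, 1%R]%classic : set (measurableTypeR R)) (fun s => complex.Im (y s)) ->
  Cintegral M `]-oo, x] (fun s => (x - s)%:C%C * y s) =
  (A * Num.max (x - x0) 0)%:C%C * y x0.
Proof.
move=> x1 mRe mIm; have sub : `]-oo, x] `<=` `]-oo, 1%R]%classic.
  by move=> s; rewrite /= !in_itv/= => /le_trans; apply.
have maxE : A * (x0 \in (`]-oo, x]%classic : set R))%:R * (x - x0) = A * Num.max (x - x0) 0.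
  rewrite mem_setE in_itv/=; case: leP => h.
    by rewrite max_l ?subr_ge0// mulr1.
  by rewrite max_r ?subr_le0 1?ltW// !mulr0 mul0r.
have ReE s : complex.Re ((x - s)%:C%C * y s) = (x - s) * complex.Re (y s).
  by case: (y s) => a b /=; rewrite mul0r subr0.
have ImE s : complex.Im ((x - s)%:C%C * y s) = (x - s) * complex.Im (y s).
  by case: (y s) => a b /=; rewrite mul0r addr0.
rewrite /Cintegral; under eq_Rintegral do rewrite ReE.
under [X in (_ +i* X)%C]eq_Rintegral do rewrite ImE.
rewrite !Rintegral_point_mass//; try by
  apply: measurable_funM; [exact: measurable_funB|exact: measurable_funS sub _].
by rewrite !mulrA maxE; case: (y x0) => a b /=; rewrite /GRing.mul/= !mul0r subr0 addr0.
Qed.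

Lemma Cintegral_point_mass1 (y : R -> R[i]) :
  measurable_fun (`]-oo, 1%R]%classic : set (measurableTypeR R)) (fun s => complex.Re (y s)) ->
  measurable_fun (`]-oo, 1%R]%classic : set (measurableTypeR R)) (fun s => complex.Im (y s)) ->
  Cintegral M `]-oo, 1] y = A%:C%C * y x0.
Proof.
move=> mRe mIm; rewrite /Cintegral !Rintegral_point_mass//.
rewrite mem_set /= ?in_itv//= mulr1.
by case: (y x0) => a b /=; rewrite /GRing.mul/= !mul0r subr0 addr0.
Qed.

(** The kernel vanishes at the atom, so y(x0) = c and y(x) = c (1 - kappa^2 A max(x - x0, 0)) with c
    nonzero; only the condition at 1 remains. Conversely this function with c = 1 is an
    eigenfunction. *)
Lemma point_mass_quasi_eigenvalue (kappa : R[i]) : kappa != 0 ->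
  quasi_eigenvalues M kappa <->
  1 - kappa ^+ 2 * (A * (1 - x0))%:C%C = - 'i%C * kappa * A%:C%C.
Proof.
move=> k0; have max1 : Num.max (1 - x0) 0 = 1 - x0 by rewrite max_l// subr_ge0.
split.
  move=> [_ [y [[[iRe iIm] [c yE]] [x x1 yx] y1]]].
  have mRe : measurable_fun (`]-oo, 1%R]%classic : set (measurableTypeR R)) (fun s => complex.Re (y s)).
    by apply/measurable_EFinP; exact: measurable_int iRe.
  have mIm : measurable_fun (`]-oo, 1%R]%classic : set (measurableTypeR R)) (fun s => complex.Im (y s)).
    by apply/measurable_EFinP; exact: measurable_int iIm.
  have y0 : y x0 = c.
    by rewrite yE// Cintegral_point_mass// subrr max_l// mulr0 mul0r mulr0 subr0.
  have yE' z : z <= 1 -> y z = c * (1 - kappa ^+ 2 * (A * Num.max (z - x0) 0)%:C%C).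
    by move=> z1; rewrite yE// Cintegral_point_mass// y0; ring.
  have c0 : c != 0 by apply: contraNneq yx => c0; rewrite yE'// c0 mul0r.
  apply: (mulfI c0); rewrite -[X in _ - _ * (_ * X)%:C%C]max1 -yE'//.
  by rewrite y1 /right_derivative_at1 Cintegral_point_mass1// y0; field.
move=> E; split => //.
pose y x := 1 - kappa ^+ 2 * (A * Num.max (x - x0) 0)%:C%C.
have ReE x : complex.Re (y x) = 1 - complex.Re (kappa ^+ 2) * (A * Num.max (x - x0) 0).
  by rewrite /y; case: (kappa ^+ 2) => a b /=; ring.
have ImE x : complex.Im (y x) = - complex.Im (kappa ^+ 2) * (A * Num.max (x - x0) 0).
  by rewrite /y; case: (kappa ^+ 2) => a b /=; ring.
have bmax : bmeas (`]-oo, 1%R]%classic : set (measurableTypeR R)) (fun x => Num.max (x - x0) 0).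
  split; first by apply: measurable_maxr => //; exact: measurable_funB.
  exists (1 - x0) => x; rewrite /= in_itv/= => x1.
  by rewrite ger0_norm ?le_max ?lexx ?orbT// ge_max subr_ge0 x0_le1 andbT; lra.
have bRe : bmeas (`]-oo, 1%R]%classic : set (measurableTypeR R)) (fun x => complex.Re (y x)).
  rewrite (funext ReE).
  by apply: bmeasB; [exact: bmeas_cst|do 2 (apply: bmeasM; first exact: bmeas_cst)].
have bIm : bmeas (`]-oo, 1%R]%classic : set (measurableTypeR R)) (fun x => complex.Im (y x)).
  rewrite (funext ImE).
  by do 2 (apply: bmeasM; first exact: bmeas_cst).
have Moo : (M `]-oo, 1%R]%classic < +oo)%E.
  by rewrite -/(Tm M) Tm_point_mass ltry.
have y0 : y x0 = 1 by rewrite /y subrr max_l// mulr0 mulr0 subr0.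
exists y; split.
- split; first by split; apply: bmeas_integrable.
  exists 1 => x x1; rewrite Cintegral_point_mass//; [|by case: bRe|by case: bIm].
  by rewrite y0 mulr1.
- by exists x0; rewrite ?y0 ?oner_neq0.
- rewrite /right_derivative_at1 Cintegral_point_mass1//; [|by case: bRe|by case: bIm].
  by rewrite y0 {1}/y max1 E; field.
Qed.

Lemma point_mass_Ad m S : A <= m -> A * (1 - x0) <= S -> Ad m S M.
Proof.
move=> Am AS; split.
- split.
    split; first by rewrite ME ?memNset ?mulr0//= in_itv/= andbT ltNge x0_le1.
    move=> a; rewrite ME; last exact: measurable_itv.
    by rewrite ltry.
  exists x0 => x Mx; rewrite leNgt; apply/negP => xx0.
  have := Mx `]-oo, x0[%classic; rewrite ME; last exact: measurable_itv.
  rewrite memNset ?mulr0 ?ltxx; last by rewrite /= in_itv/= ltxx.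
  by move=> H; suff : false by []; apply: H; [exact: lray_open|rewrite /= in_itv].
- by rewrite Tm_point_mass !lee_fin lte_fin.
- by rewrite Stm_point_mass !lee_fin mulr_ge0 ?subr_ge0// ltW.
Qed.

End PointMassIntegral.

Lemma point_mass_exists (x0 A : R) : x0 <= 1 -> 0 < A ->
  exists M, is_point_mass M x0 A.
Proof.
move=> x1 A0; exists (mscale (NngNum (ltW A0)) (dirac (x0 : measurableTypeR R))).
by split.
Qed.

Lemma point_mass_same M N (x0 A : R) :
  is_point_mass M x0 A -> is_point_mass N x0 A -> same_string M N.
Proof. by move=> [_ _ hM] [_ _ hN] B mB; rewrite hM// hN. Qed.

End PointMass.

(** * Existence and uniqueness of the optimal string for a given minimal decay *)

Section OptimalString.
Local Set Implicit Arguments.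
Local Unset Strict Implicit.
Context {R : realType} (m S : R).
Implicit Types (M N : {measure set (measurableTypeR R) -> \bar R}).

(** The infimum is attained, hence finite, so [fine] in [kappa_opt] loses nothing. *)
Lemma min_decay_attained (alpha beta : R) M :
  Ad m S M -> quasi_eigenvalues M (alpha +i* beta)%C ->
  (forall N b, Ad m S N -> quasi_eigenvalues N (alpha +i* b)%C -> beta <= b) ->
  min_decay m S alpha = beta%:E.
Proof.
move=> AdM qM h; apply/eqP; rewrite eq_le; apply/andP; split.
  by apply: ereal_inf_lbound; exists (alpha +i* beta)%C => //; split => //; exists M.
apply: le_ereal_inf_tmp => _ [[a b] /= [-> [N AdN qN]] <-].
by rewrite lee_fin; exact: h qN.
Qed.

Lemma point_mass_equations M (x0 A alpha beta : R) :
  is_point_mass M x0 A -> (alpha +i* beta)%C != 0 ->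
  quasi_eigenvalues M (alpha +i* beta)%C <->
  (alpha ^+ 2 - beta ^+ 2) * (A * (1 - x0)) + beta * A = 1 /\
  2 * alpha * beta * (A * (1 - x0)) = alpha * A.
Proof.
move=> MA k0; rewrite (point_mass_quasi_eigenvalue MA k0).
split.
  move=> E; have := congr1 (@complex.Re R) E; have := congr1 (@complex.Im R) E.
  by rewrite /= => Eim Ere; split; lra.
move=> [Ere Eim]; apply/eqP; rewrite eq_complex /=; apply/andP; split; apply/eqP; lra.
Qed.

(** The atom has mass 2 beta / nu and statical moment 1 / nu, so the two inequalities say that it is
    admissible, while minimality of [beta] excludes smaller decay. The active constraint forces
    every optimal string to be an atom, and the two real equations then fix its position and
    mass. *)
Lemma optimal_string_neq0 (alpha beta : R) : alpha != 0 -> 0 < beta ->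
  let nu := alpha ^+ 2 + beta ^+ 2 in
  1 <= S * nu -> 2 * beta <= m * nu -> S * nu = 1 \/ 2 * beta = m * nu ->
  (forall b, 0 <= b -> 1 <= S * (alpha ^+ 2 + b ^+ 2) ->
    2 * b <= m * (alpha ^+ 2 + b ^+ 2) -> beta <= b) ->
  forall M, is_point_mass M (1 - (2 * beta)^-1) (2 * beta / nu) ->
  [/\ min_decay m S alpha = beta%:E, optimal_string m S alpha M,
    Tm M = m%:E \/ Stm M = S%:E &
    forall N, optimal_string m S alpha N -> same_string N M].
Proof.
move=> a0 b0 nu hS hm eqn bmin M MA.
have nu0 : 0 < nu by rewrite ltr_wpDl ?sqr_ge0// exprn_gt0.
have bn0 := lt0r_neq0 b0; have nun0 := lt0r_neq0 nu0.
have k0 b : (alpha +i* b)%C != 0 by rewrite eq_complex /= negb_and a0.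
have dE : 1 - (1 - (2 * beta)^-1) = (2 * beta)^-1 by ring.
have AdE : 2 * beta / nu * (2 * beta)^-1 = nu^-1 by field; rewrite bn0 nun0.
have AdM : Ad m S M.
  apply: (point_mass_Ad MA); first by rewrite ler_pdivrMr.
  by rewrite dE AdE -[leLHS]mul1r ler_pdivrMr.
have qM : quasi_eigenvalues M (alpha +i* beta)%C.
  apply/(point_mass_equations MA (k0 _)); rewrite dE AdE /nu; split; field => //.
have md : min_decay m S alpha = beta%:E.
  apply: (min_decay_attained AdM qM) => N b AdN qN.
  have [/(_ a0)[? ? ? _] _] := string_bounds AdN qN.
  exact: bmin.
have kE : kappa_opt m S alpha = (alpha +i* beta)%C by rewrite /kappa_opt md.
split => //.
- by split => //; rewrite kE.
- rewrite (Tm_point_mass MA) (Stm_point_mass MA) dE AdE.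
  case: eqn => E; [right|left]; congr (_%:E).
    by apply: (mulIf nun0); rewrite E mulVf.
  by rewrite E mulfK.
move=> N [AdN]; rewrite kE => qN.
have [/(_ a0)[_ _ _ /(_ bn0 eqn)[x1 [B NB]]] _] := string_bounds AdN qN.
have [Ere Eim] := (point_mass_equations NB (k0 _)).1 qN.
have B0 : B != 0 by case: NB => _ /lt0r_neq0.
have b20 : 2 * beta != 0 by rewrite mulf_neq0 ?pnatr_eq0.
have x1b : (1 - x1) * (2 * beta) = 1.
  by apply: (mulfI (mulf_neq0 a0 B0)); rewrite mulr1 -[RHS]Eim; ring.
have x1E : 1 - x1 = (2 * beta)^-1 by apply: (mulIf b20); rewrite x1b mulVf.
have Bnu : B * nu = 2 * beta.
  (* The real equation is multiplied by 2 beta; since 2 beta (1 - x1) = 1, its left side becomes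
     (alpha^2 - beta^2) B + 2 beta^2 B = nu B. *)
  transitivity (2 * beta * ((alpha ^+ 2 - beta ^+ 2) * (B * (1 - x1)) + beta * B)).
    rewrite (_ : 2 * beta * _ = (alpha ^+ 2 - beta ^+ 2) * B *
      ((1 - x1) * (2 * beta)) + 2 * beta ^+ 2 * B); last by ring.
    by rewrite x1b /nu; ring.
  by rewrite Ere mulr1.
have BE : B = 2 * beta / nu by rewrite -Bnu mulfK.
have x1E' : x1 = 1 - (2 * beta)^-1 by rewrite -x1E; ring.
by rewrite x1E' BE in NB; exact: point_mass_same NB MA.
Qed.

(** At [alpha] = 0 the imaginary equation is void and does not locate the atom. The real one at beta
    = 1 / m reads B m = m^2 + B (1 - x1), hence B >= m; with B <= m this gives B = m and x1 = 1. *)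
Lemma optimal_string_eq0 : 0 < m -> 0 < S ->
  forall M, is_point_mass M 1 m ->
  [/\ min_decay m S 0 = m^-1%:E, optimal_string m S 0 M &
    forall N, optimal_string m S 0 N -> same_string N M].
Proof.
move=> m0 S0 M MA; have mn0 := lt0r_neq0 m0.
have k0 (b : R) : 0 < b -> (0 +i* b)%C != 0.
  by move=> b0; rewrite eq_complex /= negb_and (gt_eqF b0) orbT.
have AdM : Ad m S M by apply: (point_mass_Ad MA) => //; rewrite subrr mulr0 ltW.
have mi0 : 0 < m^-1 by rewrite invr_gt0.
have qM : quasi_eigenvalues M (0 +i* m^-1)%C.
  by apply: (point_mass_equations MA (k0 _ mi0)).2; rewrite subrr !mulr0 mul0r add0r mulVf.
have md : min_decay m S 0 = m^-1%:E.
  apply: (min_decay_attained AdM qM) => N b AdN qN.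
  have [_ /(_ erefl)[b0 bm _]] := string_bounds AdN qN.
  by rewrite -[leLHS]mul1r ler_pdivrMr.
have kE : kappa_opt m S 0 = (0 +i* m^-1)%C by rewrite /kappa_opt md.
split => //; first by split => //; rewrite kE.
move=> N [AdN]; rewrite kE => qN.
have [_ /(_ erefl)[_ _ /(_ (mulVf mn0))[x1 [B NB]]]] := string_bounds AdN qN.
have [Ere _] := (point_mass_equations NB (k0 _ mi0)).1 qN.
have Bm : B <= m by case: AdN => _ [_ +] _; rewrite (Tm_point_mass NB) lee_fin.
have [x1_le1 B0 _] := NB.
have E : B * m = m ^+ 2 + B * (1 - x1).
  have := congr1 ( *%R (m ^+ 2)) Ere; rewrite mulr1.
  rewrite (_ : m ^+ 2 * _ = B * m - B * (1 - x1)); last by field.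
  by move=> <-; rewrite subrK.
have BE : B = m.
  apply/eqP; rewrite eq_le Bm -(ler_pM2r m0) E -expr2 lerDl.
  by rewrite mulr_ge0 ?subr_ge0// ltW.
have x1E : x1 = 1.
  have : m * (1 - x1) = 0 by move: E; rewrite BE; lra.
  by move=> /eqP; rewrite mulf_eq0 (negbTE mn0) subr_eq0 => /eqP.
by rewrite BE x1E in NB; exact: point_mass_same NB MA.
Qed.

End OptimalString.

(** * The scalar minimisation problem *)

Section OptimalParameters.
Local Set Implicit Arguments.
Local Unset Strict Implicit.
Context {R : realType} (m S alpha : R) (m_gt0 : 0 < m) (S_gt0 : 0 < S).
Context (alpha_neq0 : alpha != 0).

Definition optimal_decay (beta : R) : Prop :=
  let nu := alpha ^+ 2 + beta ^+ 2 in
  [/\ 0 < beta, 1 <= S * nu, 2 * beta <= m * nu,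
    S * nu = 1 \/ 2 * beta = m * nu &
    forall b, 0 <= b -> 1 <= S * (alpha ^+ 2 + b ^+ 2) ->
      2 * b <= m * (alpha ^+ 2 + b ^+ 2) -> beta <= b].

(** The constraints and the parameters of the atom depend on [alpha] only through its square, so the
    same string serves the frequency [- alpha]. *)
Lemma optimal_string_exists beta : optimal_decay beta ->
  min_decay m S alpha \is a fin_num /\
  exists M : {measure set (measurableTypeR R) -> \bar R},
  [/\ is_point_mass M (1 - (2 * beta)^-1) (2 * beta / (alpha ^+ 2 + beta ^+ 2)),
    optimal_string m S alpha M, Tm M = m%:E \/ Stm M = S%:E,
    forall N : {measure set (measurableTypeR R) -> \bar R},
      optimal_string m S alpha N -> same_string N M &
    forall N : {measure set (measurableTypeR R) -> \bar R},
      optimal_string m S (- alpha) N -> same_string N M].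
Proof.
move=> [b0 hS hm eqn bmin].
have nu0 : 0 < alpha ^+ 2 + beta ^+ 2 by rewrite ltr_wpDl ?sqr_ge0// exprn_gt0.
have [M MA] : exists M, is_point_mass M (1 - (2 * beta)^-1) (2 * beta / (alpha ^+ 2 + beta ^+ 2)).
  by apply: point_mass_exists; rewrite ?divr_gt0 ?mulr_gt0// gerBl invr_ge0 mulr_ge0// ltW.
have [md optM TS uniq] := optimal_string_neq0 alpha_neq0 b0 hS hm eqn bmin MA.
split; first by rewrite md.
exists M; split => //.
have an0 : - alpha != 0 by rewrite oppr_eq0.
by case: (@optimal_string_neq0 R m S (- alpha) beta an0 b0 _ _ _ _ M); rewrite ?sqrrN.
Qed.

(** The moment constraint is active and, being monotone in b, gives minimality. The mass constraint
    becomes 2 s <= m / S; squared, it is the threshold on alpha^2, and it is automatic when 4 S <=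
    m^2. *)
Lemma optimal_decay_moment : alpha ^+ 2 < S^-1 ->
  S <= m ^+ 2 / 4 \/ 1 / S - m ^+ 2 / (4 * S ^+ 2) <= alpha ^+ 2 ->
  optimal_decay (Num.sqrt (S^-1 - alpha ^+ 2)).
Proof.
move=> aS hyp; set s := Num.sqrt _; have Sn0 := lt0r_neq0 S_gt0.
have s2 : s ^+ 2 = S^-1 - alpha ^+ 2 by rewrite sqr_sqrtr// subr_ge0 ltW.
have s0 : 0 < s by rewrite sqrtr_gt0 subr_gt0.
have nuE : alpha ^+ 2 + s ^+ 2 = S^-1 by rewrite s2; ring.
have SnuE : S * (alpha ^+ 2 + s ^+ 2) = 1 by rewrite nuE mulfV.
split => //; rewrite ?SnuE//; last first.
- move=> b b0; rewrite -ler_pdivrMl// mulr1 -nuE lerD2l.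
  by rewrite ler_pXn2r ?nnegrE ?(ltW s0).
- by left.
rewrite nuE ler_pdivlMr// -(@ler_pXn2r _ 2) ?nnegrE ?mulr_ge0 ?(ltW s0) ?(ltW S_gt0) ?(ltW m_gt0)//.
rewrite !exprMn s2.
have -> : 2 ^+ 2 * (S^-1 - alpha ^+ 2) * S ^+ 2 = 4 * S - 4 * (alpha ^+ 2 * S ^+ 2) by field.
case: hyp => h.
  have := mulr_ge0 (sqr_ge0 alpha) (sqr_ge0 S); lra.
have : (1 / S - m ^+ 2 / (4 * S ^+ 2)) * S ^+ 2 <= alpha ^+ 2 * S ^+ 2 by rewrite ler_wpM2r// sqr_ge0.
by rewrite (_ : (_ - _) * S ^+ 2 = S - m ^+ 2 / 4); [lra|field].
Qed.

(** In c = b m the mass constraint is (c - 1)^2 >= r^2, so c <= 1 - r or c >= 1 + r. The lower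
    branch violates the moment constraint, and the minimum is at c = 1 + r. *)
Lemma optimal_decay_mass : m ^+ 2 / 4 < S ->
  alpha ^+ 2 < 1 / S - m ^+ 2 / (4 * S ^+ 2) ->
  optimal_decay ((1 + Num.sqrt (1 - alpha ^+ 2 * m ^+ 2)) / m).
Proof.
move=> mS aX; set r := Num.sqrt _; have Sn0 := lt0r_neq0 S_gt0; have mn0 := lt0r_neq0 m_gt0.
have m2 : 0 < m ^+ 2 by rewrite exprn_gt0.
(* 2 k = m^2 / S is the lower bound that the moment constraint puts on alpha^2 m^2 + c^2, and the
   threshold on alpha becomes |1 - k| < r. *)
pose k := m ^+ 2 / (2 * S).
have kr : (1 - k) ^+ 2 < 1 - alpha ^+ 2 * m ^+ 2.
  have : alpha ^+ 2 * m ^+ 2 < (1 / S - m ^+ 2 / (4 * S ^+ 2)) * m ^+ 2 by rewrite ltr_pM2r.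
  rewrite (_ : (1 / S - _) * _ = 1 - (1 - k) ^+ 2); [lra|by rewrite /k; field].
have r2 : r ^+ 2 = 1 - alpha ^+ 2 * m ^+ 2.
  by rewrite sqr_sqrtr// (le_trans (sqr_ge0 (1 - k)))// ltW.
have r0 : 0 <= r by exact: sqrtr_ge0.
have [kr1 kr2] : k - 1 < r /\ 1 - k < r.
  have : `|1 - k| < r.
    by rewrite -(@ltr_pXn2r _ 2) ?nnegrE// real_normK ?num_real// r2.
  by rewrite ltr_norml => /andP[? ?]; split; lra.
have nuE : alpha ^+ 2 + ((1 + r) / m) ^+ 2 = 2 * (1 + r) / m ^+ 2.
  have -> : alpha ^+ 2 = (1 - r ^+ 2) / m ^+ 2 by rewrite r2; field.
  by field.
have SE x : (1 <= S * x) = (2 * k <= m ^+ 2 * x).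
  rewrite (_ : 2 * k = m ^+ 2 * S^-1); last by rewrite /k; field.
  by rewrite ler_pM2l// -[S^-1]mulr1 ler_pdivrMl.
split.
- by rewrite divr_gt0// ltr_pwDl.
- rewrite nuE SE (_ : m ^+ 2 * _ = 2 * (1 + r)); [lra|by field].
- by rewrite nuE (_ : m * _ = 2 * ((1 + r) / m)); [|by field].
- by right; rewrite nuE; field.
move=> b b0; rewrite SE => hS hm.
rewrite ler_pdivrMr// leNgt; apply/negP.
have : m * (2 * b) <= m * (m * (alpha ^+ 2 + b ^+ 2)) by rewrite ler_pM2l.
have : 0 <= b * m by rewrite mulr_ge0// ltW.
rewrite (_ : m * (2 * b) = 2 * (b * m)); last by ring.
rewrite (_ : m * (m * _) = alpha ^+ 2 * m ^+ 2 + (b * m) ^+ 2); last by ring.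
have : 2 * k <= alpha ^+ 2 * m ^+ 2 + (b * m) ^+ 2 by apply: le_trans hS _; rewrite le_eqVlt; apply/orP; left; apply/eqP; ring.
rewrite (_ : alpha ^+ 2 * m ^+ 2 = 1 - r ^+ 2); last by rewrite r2; ring.
move: (b * m) => c hS' c0 hm' cr.
have c1r : c <= 1 - r.
  rewrite leNgt; apply/negP => rc.
  have : 0 < (c - (1 - r)) * (1 + r - c) by rewrite mulr_gt0 ?subr_gt0.
  rewrite (_ : _ * _ = 2 * c - (1 - r ^+ 2) - c ^+ 2); [lra|by ring].
(* On the lower branch alpha^2 m^2 + c^2 <= 1 - r^2 + (1 - r)^2 = 2 (1 - r) < 2 k. *)
have : c ^+ 2 <= (1 - r) ^+ 2 by rewrite ler_pXn2r ?nnegrE// (le_trans c0).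
rewrite (_ : (1 - r) ^+ 2 = 1 - 2 * r + r ^+ 2); [lra|by ring].
Qed.

End OptimalParameters.

Theorem theorem2p4 (R : realType) (m S alpha : R)
    (m_gt0 : 0 < m) (S_gt0 : 0 < S)
    (alpha_gt : - (Num.sqrt S)^-1 < alpha) (alpha_lt : alpha < (Num.sqrt S)^-1) :
  min_decay m S alpha \is a fin_num /\
  exists M : {measure set (measurableTypeR R) -> \bar R},
    optimal_string m S alpha M /\
    (forall N : {measure set (measurableTypeR R) -> \bar R},
       optimal_string m S alpha N -> same_string N M) /\
    (exists x0 A : R, is_point_mass M x0 A) /\
    (Tm M = m%:E \/ Stm M = S%:E) /\
    (alpha = 0 -> is_point_mass M 1 m) /\
    (0 < alpha ->
       (forall N : {measure set (measurableTypeR R) -> \bar R},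
          optimal_string m S (- alpha) N -> same_string N M) /\
       (S <= m ^+ 2 / 4 ->
          is_point_mass M
            (1 - 1 / (2 * Num.sqrt (S^-1 - alpha ^+ 2)))
            (2 * S * Num.sqrt (S^-1 - alpha ^+ 2))) /\
       (m ^+ 2 / 4 < S ->
          (alpha < Num.sqrt (1 / S - m ^+ 2 / (4 * S ^+ 2)) ->
             is_point_mass M
               (1 - m / (2 + 2 * Num.sqrt (1 - alpha ^+ 2 * m ^+ 2)))
               m) /\
          (Num.sqrt (1 / S - m ^+ 2 / (4 * S ^+ 2)) <= alpha ->
             is_point_mass M
               (1 - 1 / (2 * Num.sqrt (S^-1 - alpha ^+ 2)))
               (2 * S * Num.sqrt (S^-1 - alpha ^+ 2))))).
Proof.
have S2 : (Num.sqrt S)^-1 ^+ 2 = S^-1 by rewrite exprVn sqr_sqrtr// ltW.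
have alpha2 : alpha ^+ 2 < S^-1.
  by rewrite -S2 -[ltLHS]real_normK ?num_real// ltr_pXn2r ?nnegrE ?invr_ge0 ?sqrtr_ge0// ltr_norml alpha_gt.
have [a0|a0] := eqVneq alpha 0.
  subst alpha; have [M MA] := point_mass_exists (lexx 1) m_gt0.
  have [md optM uniq] := optimal_string_eq0 m_gt0 S_gt0 MA.
  split; first by rewrite md.
  exists M; split => //; split => //; split; first by exists 1, m.
  by split; [left; exact: Tm_point_mass MA|split => //; rewrite ltxx].
have Sn0 := lt0r_neq0 S_gt0; have mn0 := lt0r_neq0 m_gt0.
pose X := 1 / S - m ^+ 2 / (4 * S ^+ 2).
have moment_case : S <= m ^+ 2 / 4 \/ X <= alpha ^+ 2 ->
    min_decay m S alpha \is a fin_num /\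
    exists M : {measure set (measurableTypeR R) -> \bar R},
    [/\ is_point_mass M (1 - 1 / (2 * Num.sqrt (S^-1 - alpha ^+ 2)))
         (2 * S * Num.sqrt (S^-1 - alpha ^+ 2)),
      optimal_string m S alpha M, Tm M = m%:E \/ Stm M = S%:E,
      forall N : {measure set (measurableTypeR R) -> \bar R},
        optimal_string m S alpha N -> same_string N M &
      forall N : {measure set (measurableTypeR R) -> \bar R},
        optimal_string m S (- alpha) N -> same_string N M].
  move=> hyp; have [fin [M [MA optM TS uniq uniqN]]] :=
    optimal_string_exists a0 (optimal_decay_moment m_gt0 S_gt0 alpha2 hyp).
  split => //; exists M; split => //.
  (* Here nu = 1 / S, so the mass 2 beta / nu is 2 S beta. *)
  rewrite div1r; move: MA; rewrite sqr_sqrtr; last by rewrite subr_ge0 ltW.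
  by rewrite [alpha ^+ 2 + _]addrC subrK invrK mulrAC.
have mass_case : m ^+ 2 / 4 < S -> alpha ^+ 2 < X ->
    min_decay m S alpha \is a fin_num /\
    exists M : {measure set (measurableTypeR R) -> \bar R},
    [/\ is_point_mass M (1 - m / (2 + 2 * Num.sqrt (1 - alpha ^+ 2 * m ^+ 2))) m,
      optimal_string m S alpha M, Tm M = m%:E \/ Stm M = S%:E,
      forall N : {measure set (measurableTypeR R) -> \bar R},
        optimal_string m S alpha N -> same_string N M &
      forall N : {measure set (measurableTypeR R) -> \bar R},
        optimal_string m S (- alpha) N -> same_string N M].
  move=> mS aX; have [fin [M [MA optM TS uniq uniqN]]] :=
    optimal_string_exists a0 (optimal_decay_mass m_gt0 S_gt0 mS aX).
  split => //; exists M; split => //.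
  set r := Num.sqrt _ in MA *; have r0 : 0 <= r by exact: sqrtr_ge0.
  have r1 : 1 + r != 0 by rewrite gt_eqF// ltr_pwDl.
  (* The radicand is nonnegative: alpha^2 m^2 < X m^2 = 1 - (1 - m^2 / (2 S))^2 <= 1. *)
  have a2E : alpha ^+ 2 = (1 - r ^+ 2) / m ^+ 2.
    rewrite sqr_sqrtr; first by field.
    have : alpha ^+ 2 * m ^+ 2 < X * m ^+ 2 by rewrite ltr_pM2r// exprn_gt0.
    rewrite (_ : X * _ = 1 - (1 - m ^+ 2 / (2 * S)) ^+ 2); last by rewrite /X; field.
    have := sqr_ge0 (1 - m ^+ 2 / (2 * S)); lra.
  (* With beta = (1 + r) / m one has nu = 2 beta / m, so the mass 2 beta / nu is m. *)
  move: MA; rewrite a2E.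
  have r2 : 2 + 2 * r != 0 by rewrite gt_eqF// ltr_pwDl ?mulr_ge0.
  rewrite (_ : (2 * ((1 + r) / m))^-1 = m / (2 + 2 * r)); last by field; rewrite r1 r2 mn0.
  rewrite (_ : _ / m ^+ 2 + _ = 2 * (1 + r) / m ^+ 2); last by field.
  by rewrite (_ : 2 * ((1 + r) / m) / _ = m)//; field; rewrite r1 mn0.
(* [Num.sqrt] is 0 on negative numbers, so comparing squares requires X >= 0, which holds when S >
   m^2 / 4. *)
have thr : m ^+ 2 / 4 < S -> 0 < alpha -> (alpha < Num.sqrt X) = (alpha ^+ 2 < X).
  move=> mS al0; have X0 : 0 <= X.
    rewrite (_ : X = (S - m ^+ 2 / 4) / S ^+ 2); last by rewrite /X; field.
    by rewrite divr_ge0 ?sqr_ge0// subr_ge0 ltW.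
  rewrite -{2}(sqr_sqrtr X0) ltr_pXn2r ?nnegrE ?sqrtr_ge0//; exact: ltW.
have [Sm|mS] : S <= m ^+ 2 / 4 \/ m ^+ 2 / 4 < S by case: leP; [left|right].
  have [fin [M [MA optM TS uniq uniqN]]] := moment_case (or_introl Sm).
  split => //; exists M; split => //; split => //.
  split; first by do 2 eexists; exact: MA.
  split => //; split; first by move=> /eqP; rewrite (negbTE a0).
  move=> al0; split => //.
  split; first by move=> _; exact: MA.
  by rewrite ltNge Sm.
have [Xa|aX] := leP X (alpha ^+ 2).
  have [fin [M [MA optM TS uniq uniqN]]] := moment_case (or_intror Xa).
  split => //; exists M; split => //; split => //.
  split; first by do 2 eexists; exact: MA.
  split => //; split; first by move=> /eqP; rewrite (negbTE a0).
  move=> al0; split => //.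
  split=> [_|_]; first exact: MA.
  by split=> [|_]; [rewrite -/X thr// ltNge Xa|exact: MA].
have [fin [M [MA optM TS uniq uniqN]]] := mass_case mS aX.
split => //; exists M; split => //; split => //.
split; first by do 2 eexists; exact: MA.
  split => //; split; first by move=> /eqP; rewrite (negbTE a0).
  move=> al0; split => //.
split; first by rewrite leNgt mS.
by split=> [_|]; [exact: MA|rewrite -/X leNgt thr// aX].
Qed.
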